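(* Let $k\ge 2$ be a constant integer and let $f(n)=o(\log\log n)$ be an arbitrary function with $f(n)\to\infty$. Let $G(n)$ be a random $k$-tree on $n+k$ vertices, and suppose that initially a vertex of $G(n)$ chosen uniformly at random knows a rumor. Then there is a constant $C>0$ such that, with probability $1-o(1)$ as $n\to\infty$, after $C\,(\log n)^{1+\frac{2}{k}}\cdot \log\log n\cdot f(n)^{\frac{3}{k}}$ rounds of the Push-Pull protocol, at least $n-o(n)$ vertices know the rumor.
   Context: Random $k$-tree process: $G(0)$ is a clique on $k$ vertices; for $t=1,2,\dots,n$, $G(t)$ is obtained from $G(t-1)$ by choosing a $k$-clique of $G(t-1)$ uniformly at random, creating a new vertex, and joining it to all $k$ vertices of the chosen clique. $G(n)$ is called a random $k$-tree on $n+k$ vertices. Push-Pull protocol on a graph: initially some vertices know a rumor; the protocol proceeds in synchronous rounds; in each round, every informed vertex contacts a uniformly random neighbor and sends it the rumor (push), and every uninformed vertex contacts a uniformly random neighbor and receives the rumor if that neighbor knows it (pull); all random choices are independent, and a vertex informed in a round cannot forward the rumor in that same round. *)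

(* Defs.v *)
From Stdlib Require Import Reals List Arith Bool.
Import ListNotations.
Open Scope R_scope.

Definition dist (A : Type) : Type := list (R * A).

Definition dret {A} (x : A) : dist A := [(1, x)].

Definition dbind {A B} (d : dist A) (f : A -> dist B) : dist B :=
  flat_map (fun px => map (fun qy => (fst px * fst qy, snd qy)) (f (snd px))) d.

Definition uniform {A} (l : list A) : dist A :=
  map (fun x => (/ INR (length l), x)) l.

Definition prob {A} (d : dist A) (P : A -> bool) : R :=
  fold_right Rplus 0 (map (fun px => if P (snd px) then fst px else 0) d).

Record graph : Type := mkGraph { nv : nat; adj : nat -> nat -> bool }.

Definition vertices (G : graph) : list nat := seq 0 (nv G).

Fixpoint choose (k : nat) (l : list nat) : list (list nat) :=
  match l with
  | [] => match k with 0%nat => [[]] | S _ => [] end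
  | x :: l' => match k with
               | 0%nat => [[]]
               | S k' => map (cons x) (choose k' l') ++ choose k l'
               end
  end.

Definition is_clique (G : graph) (K : list nat) : bool :=
  forallb (fun x => forallb (fun y => Nat.eqb x y || adj G x y) K) K.

Definition kcliques (k : nat) (G : graph) : list (list nat) :=
  filter (is_clique G) (choose k (vertices G)).

Definition clique_graph (k : nat) : graph :=
  mkGraph k (fun x y => negb (Nat.eqb x y) && Nat.ltb x k && Nat.ltb y k).

Definition attach (G : graph) (K : list nat) : graph :=
  let v := nv G in
  mkGraph (S v) (fun x y =>
    adj G x y
    || (Nat.eqb x v && existsb (Nat.eqb y) K)
    || (Nat.eqb y v && existsb (Nat.eqb x) K)).

Definition ktree_step (k : nat) (G : graph) : dist graph :=
  dbind (uniform (kcliques k G)) (fun K => dret (attach G K)).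

Fixpoint random_ktree (k n : nat) : dist graph :=
  match n with
  | 0%nat => dret (clique_graph k)
  | S n' => dbind (random_ktree k n') (ktree_step k)
  end.

Definition neighbors (G : graph) (v : nat) : list nat :=
  filter (adj G v) (vertices G).

Fixpoint contacts (G : graph) (vs : list nat) : dist (nat -> nat) :=
  match vs with
  | [] => dret (fun _ => 0%nat)
  | v :: vs' =>
      dbind (uniform (neighbors G v)) (fun c =>
      dbind (contacts G vs') (fun h =>
      dret (fun x => if Nat.eqb x v then c else h x)))
  end.

Definition pushpull_round (G : graph) (I : nat -> bool) : dist (nat -> bool) :=
  dbind (contacts G (vertices G)) (fun c =>
    dret (fun u => I u
                   || I (c u)
                   || existsb (fun v => I v && Nat.eqb (c v) u) (vertices G))).

Fixpoint pushpull (T : nat) (G : graph) (I : nat -> bool) : dist (nat -> bool) :=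
  match T with
  | 0%nat => dret I
  | S T' => dbind (pushpull_round G I) (fun I' => pushpull T' G I')
  end.

Definition num_informed (G : graph) (I : nat -> bool) : nat :=
  length (filter I (vertices G)).

Definition informed_after (k n T : nat) : dist nat :=
  dbind (random_ktree k n) (fun G =>
  dbind (uniform (vertices G)) (fun v0 =>
  dbind (pushpull T G (fun u => Nat.eqb u v0)) (fun I =>
  dret (num_informed G I)))).

Definition nrounds (x : R) : nat := Z.to_nat (up x).

Definition round_bound (C : R) (k n : nat) (f : nat -> R) : R :=
  C * Rpower (ln (INR n)) (1 + 2 / INR k) * ln (ln (INR n))
    * Rpower (f n) (3 / INR k).

(* Main.v *)
(* Send every new vertex v to its parent, the youngest vertex of the clique it is attached to; the
   resulting tree is essentially a random recursive tree, so the average depth is O(log n). A tree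
   edge ab is crossed through the youngest vertex w attached to a clique containing both a and b
   (or through a itself), which takes O(deg w) rounds in expectation. At a time when there are N
   cliques, w is replaced by a vertex of degree k with probability at least (k-1)/N, while deg w
   increases by 1 with probability at most (k-1) deg w / N. Hence, for every b < 1, the drift of
   (deg w)^b is at most (k-1)/N * (k^b - (1-b) (deg w)^b), and (deg w)^b stays bounded in
   expectation. Summing over the paths to the root gives an expected total of O(n log n).
   Given the graph, the rumor goes from x to y within T rounds except with probability at most
   min(1, sum_w 2 deg w / T) <= sum_w (2 deg w / T)^b, w ranging over both paths to the root; the
   choice b = k/(k+2) turns the expected number of uninformed vertices into
   O(n log n / T^b) = o(n) for T = (log n)^(1+2/k) loglog n. *)
From Stdlib Require Import Reals ZArith List Arith Bool Lra Lia.
Require Import Defs.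
Import ListNotations.
Open Scope R_scope.

(** * Sums over lists and expectations *)

Definition rsum {A} (f : A -> R) (l : list A) : R :=
  fold_right Rplus 0 (map f l).

Definition ind (b : bool) : R := if b then 1 else 0.

(** A plain weighted sum, without normalisation: linearity and [expect_bind] hold for every weighted
    list, while monotonicity and the value on constants need [is_pd]. *)
Definition expect {A} (d : dist A) (f : A -> R) : R :=
  rsum (fun px => fst px * f (snd px)) d.

Lemma rsum_cons {A} (f : A -> R) x l : rsum f (x :: l) = f x + rsum f l.
Proof. reflexivity. Qed.

Lemma rsum_app {A} (f : A -> R) l l' : rsum f (l ++ l') = rsum f l + rsum f l'.
Proof.
  induction l as [|x l IH]; simpl.
  - unfold rsum; simpl; ring.
  - rewrite !rsum_cons, IH; ring.
Qed.

Lemma rsum_map {A B} (f : B -> R) (g : A -> B) l :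
  rsum f (map g l) = rsum (fun x => f (g x)) l.
Proof. unfold rsum; rewrite map_map; reflexivity. Qed.

Lemma rsum_ext {A} (f g : A -> R) l :
  (forall x, In x l -> f x = g x) -> rsum f l = rsum g l.
Proof. intros H; unfold rsum; f_equal; apply map_ext_in; exact H. Qed.

Lemma rsum_le {A} (f g : A -> R) l :
  (forall x, In x l -> f x <= g x) -> rsum f l <= rsum g l.
Proof.
  induction l as [|x l IH]; intros H.
  - unfold rsum; simpl; lra.
  - rewrite !rsum_cons; apply Rplus_le_compat; [apply H; now left|].
    apply IH; intros y Hy; apply H; now right.
Qed.

Lemma rsum_plus {A} (f g : A -> R) l :
  rsum (fun x => f x + g x) l = rsum f l + rsum g l.
Proof.
  induction l as [|x l IH]; [unfold rsum; simpl; ring|].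
  rewrite !rsum_cons, IH; ring.
Qed.

Lemma rsum_scal {A} c (f : A -> R) l : rsum (fun x => c * f x) l = c * rsum f l.
Proof.
  induction l as [|x l IH]; [unfold rsum; simpl; ring|].
  rewrite !rsum_cons, IH; ring.
Qed.

Lemma rsum_const {A} c (l : list A) : rsum (fun _ => c) l = INR (length l) * c.
Proof.
  induction l as [|x l IH]; [unfold rsum; simpl; ring|].
  rewrite rsum_cons, IH; simpl length; rewrite S_INR; ring.
Qed.

Lemma rsum_nonneg {A} (f : A -> R) l : (forall x, In x l -> 0 <= f x) -> 0 <= rsum f l.
Proof.
  intros H; rewrite <- (Rmult_0_r (INR (length l))), <- rsum_const.
  now apply rsum_le.
Qed.

Lemma rsum_swap {A B} (f : A -> B -> R) l l' :
  rsum (fun x => rsum (f x) l') l = rsum (fun y => rsum (fun x => f x y) l) l'.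
Proof.
  induction l as [|x l IH].
  - symmetry; rewrite (rsum_ext _ (fun _ => 0)) by reflexivity.
    rewrite rsum_const; unfold rsum; simpl; ring.
  - rewrite rsum_cons, IH, <- rsum_plus; reflexivity.
Qed.

Lemma rsum_flat_map {A B} (f : B -> R) (g : A -> list B) l :
  rsum f (flat_map g l) = rsum (fun x => rsum f (g x)) l.
Proof.
  induction l as [|x l IH]; [reflexivity|].
  simpl; rewrite rsum_app, IH; reflexivity.
Qed.

Lemma rsum_filter {A} (p : A -> bool) (f : A -> R) l :
  rsum f (filter p l) = rsum (fun x => ind (p x) * f x) l.
Proof.
  induction l as [|x l IH]; [reflexivity|].
  simpl; rewrite rsum_cons; unfold ind at 1; destruct (p x).
  - rewrite rsum_cons, IH; ring.
  - rewrite IH; ring.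
Qed.

Lemma length_filter_ind {A} (p : A -> bool) l :
  INR (length (filter p l)) = rsum (fun x => ind (p x)) l.
Proof.
  rewrite <- (Rmult_1_r (INR _)), <- rsum_const, rsum_filter.
  apply rsum_ext; intros; ring.
Qed.

Lemma rsum_ge_term {A} (f : A -> R) l x :
  (forall y, In y l -> 0 <= f y) -> In x l -> f x <= rsum f l.
Proof.
  induction l as [|y l IH]; intros Hf [].
  - subst y; rewrite rsum_cons.
    enough (0 <= rsum f l) by lra.
    apply rsum_nonneg; intros z Hz; apply Hf; now right.
  - rewrite rsum_cons.
    assert (0 <= f y) by (apply Hf; now left).
    enough (f x <= rsum f l) by lra.
    apply IH; [|assumption]; intros z Hz; apply Hf; now right.
Qed.

Lemma expect_ret {A} (x : A) f : expect (dret x) f = f x.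
Proof. unfold expect, dret, rsum; simpl; ring. Qed.

Lemma expect_bind {A B} (d : dist A) (h : A -> dist B) f :
  expect (dbind d h) f = expect d (fun x => expect (h x) f).
Proof.
  unfold expect, dbind; rewrite rsum_flat_map.
  apply rsum_ext; intros [p x] _; simpl.
  rewrite rsum_map, <- rsum_scal; apply rsum_ext; intros [q y] _; simpl; ring.
Qed.

Lemma expect_uniform {A} (l : list A) f :
  expect (uniform l) f = rsum f l / INR (length l).
Proof.
  unfold expect, uniform; rewrite rsum_map; simpl.
  rewrite rsum_scal; unfold Rdiv; ring.
Qed.

Lemma expect_plus {A} (d : dist A) f g :
  expect d (fun x => f x + g x) = expect d f + expect d g.
Proof.
  unfold expect; rewrite <- rsum_plus; apply rsum_ext; intros; ring.
Qed.

Lemma expect_scal {A} (d : dist A) c f :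
  expect d (fun x => c * f x) = c * expect d f.
Proof.
  unfold expect; rewrite <- rsum_scal; apply rsum_ext; intros; ring.
Qed.

Lemma prob_expect {A} (d : dist A) P : prob d P = expect d (fun x => ind (P x)).
Proof.
  unfold prob, expect, rsum; f_equal; apply map_ext; intros [p x]; unfold ind; simpl.
  destruct (P x); ring.
Qed.

(** * Supports and probability distributions *)

Definition supp {A} (d : dist A) (x : A) : Prop := exists p, In (p, x) d.

Record is_pd {A} (d : dist A) : Prop := {
  pd_nonneg : forall p x, In (p, x) d -> 0 <= p;
  pd_mass : expect d (fun _ => 1) = 1 }.

Lemma expect_ext {A} (d : dist A) f g :
  (forall x, supp d x -> f x = g x) -> expect d f = expect d g.
Proof.
  intros H; apply rsum_ext; intros [p x] Hx; simpl; rewrite H; [ring|now exists p].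
Qed.

Lemma expect_le {A} (d : dist A) f g :
  is_pd d -> (forall x, supp d x -> f x <= g x) -> expect d f <= expect d g.
Proof.
  intros Hd H; apply rsum_le; intros [p x] Hx; simpl.
  apply Rmult_le_compat_l; [now apply (pd_nonneg d Hd p x)|apply H; now exists p].
Qed.

Lemma expect_const {A} (d : dist A) c : is_pd d -> expect d (fun _ => c) = c.
Proof.
  intros Hd; rewrite (expect_ext d _ (fun _ => c * 1)) by (intros; ring).
  rewrite expect_scal, (pd_mass d Hd); ring.
Qed.

Lemma supp_ret {A} (x y : A) : supp (dret x) y -> y = x.
Proof. intros [p [H|[]]]; now inversion H. Qed.

Lemma supp_bind {A B} (d : dist A) (h : A -> dist B) y :
  supp (dbind d h) y -> exists x, supp d x /\ supp (h x) y.
Proof.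
  intros [p Hp]; unfold dbind in Hp; apply in_flat_map in Hp.
  destruct Hp as [[q x] [Hx Hy]]; apply in_map_iff in Hy.
  destruct Hy as [[r z] [Hz Hr]]; simpl in *; inversion Hz; subst.
  exists x; split; [now exists q|now exists r].
Qed.

Lemma supp_uniform {A} (l : list A) x : supp (uniform l) x -> In x l.
Proof.
  intros [p Hp]; unfold uniform in Hp; apply in_map_iff in Hp.
  destruct Hp as [y [Hy Hl]]; now inversion Hy; subst.
Qed.

Lemma is_pd_ret {A} (x : A) : is_pd (dret x).
Proof.
  split.
  - intros p y [H|[]]; inversion H; lra.
  - now rewrite expect_ret.
Qed.

Lemma is_pd_uniform {A} (l : list A) : l <> [] -> is_pd (uniform l).
Proof.
  intros Hl.
  assert (Hlen : 0 < INR (length l)).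
  { apply lt_0_INR; destruct l; [contradiction|simpl; lia]. }
  split.
  - intros p x Hp; unfold uniform in Hp; apply in_map_iff in Hp.
    destruct Hp as [y [Hy _]]; inversion Hy; subst.
    now apply Rlt_le, Rinv_0_lt_compat.
  - rewrite expect_uniform, rsum_const; field; lra.
Qed.

Lemma is_pd_bind {A B} (d : dist A) (h : A -> dist B) :
  is_pd d -> (forall x, supp d x -> is_pd (h x)) -> is_pd (dbind d h).
Proof.
  intros Hd Hh; split.
  - intros p y Hp; unfold dbind in Hp; apply in_flat_map in Hp.
    destruct Hp as [[q x] [Hx Hy]]; apply in_map_iff in Hy.
    destruct Hy as [[r z] [Hz Hr]]; simpl in *; inversion Hz; subst.
    apply Rmult_le_pos; [eapply pd_nonneg; eauto|].
    apply (pd_nonneg (h x)) with y; [apply Hh; now exists q|assumption].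
  - rewrite expect_bind; etransitivity; [|exact (pd_mass d Hd)].
    apply expect_ext; intros x Hx; apply pd_mass; now apply Hh.
Qed.

(** * Concave powers *)

Lemma Rpower_bernoulli b x :
  0 < b < 1 -> 0 <= x -> Rpower (1 + x) b <= 1 + b * x.
Proof.
  intros Hb Hx; unfold Rpower.
  set (u := ln (1 + x)).
  assert (Hu : 1 + x = exp u) by (unfold u; rewrite exp_ln; lra).
  replace (1 + b * x) with (1 - b + b * exp u) by (rewrite <- Hu; ring).
  (* Convexity of exp: compare 0 and u with the tangent at the barycentre b * u. *)
  assert (H1 : exp u = exp (b * u) * exp ((1 - b) * u)) by (rewrite <- exp_plus; f_equal; ring).
  assert (H2 : 1 = exp (b * u) * exp (- (b * u))).
  { rewrite <- exp_plus; replace (b * u + - (b * u)) with 0 by ring; now rewrite exp_0. }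
  pose proof (exp_ineq1_le ((1 - b) * u)) as H3.
  pose proof (exp_ineq1_le (- (b * u))) as H4.
  pose proof (exp_pos (b * u)) as H5.
  rewrite H1; rewrite H2 at 1.
  set (E := exp (b * u)) in *.
  assert (E * (1 + (1 - b) * u) <= E * exp ((1 - b) * u)) by (apply Rmult_le_compat_l; lra).
  assert (E * (1 + - (b * u)) <= E * exp (- (b * u))) by (apply Rmult_le_compat_l; lra).
  replace (E * exp (- (b * u)) - b + b * (E * exp ((1 - b) * u)))
    with ((1 - b) * (E * exp (- (b * u))) + b * (E * exp ((1 - b) * u)))
    by (rewrite <- H2; ring).
  nra.
Qed.

Lemma ln_le x y : 0 < x -> x <= y -> ln x <= ln y.
Proof.
  intros Hx [H| ->]; [left; now apply ln_increasing|lra].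
Qed.

Lemma Rpower_pos x b : 0 < Rpower x b.
Proof. apply exp_pos. Qed.

(** Bernoulli's inequality for [1 + / d], scaled by [Rpower d b]. It bounds the growth of a power of
    a degree when that degree goes up by one. *)
Lemma Rpower_succ_le b d : 0 < b < 1 -> 1 <= d ->
  Rpower (d + 1) b <= Rpower d b + b * (Rpower d b / d).
Proof.
  intros Hb Hd.
  assert (Hd' : 0 < / d) by (apply Rinv_0_lt_compat; lra).
  replace (d + 1) with (d * (1 + / d)) by (field; lra).
  rewrite <- Rpower_mult_distr by lra.
  pose proof (Rpower_bernoulli b (/ d) Hb) as H.
  pose proof (Rpower_pos d b).
  replace (Rpower d b + b * (Rpower d b / d)) with (Rpower d b * (1 + b * / d)) by (field; lra).
  apply Rmult_le_compat_l; lra.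
Qed.

Lemma Rpower_le_base b d : 0 < b < 1 -> 1 <= d -> Rpower d b <= d.
Proof.
  intros Hb Hd; rewrite <- (Rpower_1 d) at 2 by lra.
  apply Rle_Rpower; lra.
Qed.

(** This is [Rpower_le_base] at [/ z], with both sides inverted. *)
Lemma Rpower_small b z : 0 < b < 1 -> 0 < z <= 1 -> z <= Rpower z b.
Proof.
  intros Hb Hz.
  assert (Hi : 1 <= / z) by (rewrite <- Rinv_1; apply Rinv_le_contravar; lra).
  pose proof (Rpower_le_base b (/ z) Hb Hi) as H.
  assert (E : Rpower (/ z) b = / Rpower z b).
  { unfold Rpower; rewrite ln_Rinv by lra.
    rewrite <- exp_Ropp; f_equal; ring. }
  rewrite E in H.
  pose proof (Rpower_pos z b) as Hp.
  apply (Rmult_le_compat_l (z * Rpower z b)) in H; [|nra].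
  replace (z * Rpower z b * / Rpower z b) with z in H by (field; lra).
  replace (z * Rpower z b * / z) with (Rpower z b) in H by (field; lra).
  exact H.
Qed.

(* A union bound in disguise: either some summand is at least 1, or each is dominated by its
   power. *)
Lemma min_one_sum_le_sum_Rpower {A} b (z : A -> R) l q : 0 < b < 1 ->
  (forall x, In x l -> 0 < z x) -> q <= 1 -> q <= rsum z l ->
  q <= rsum (fun x => Rpower (z x) b) l.
Proof.
  intros Hb Hz Hq Hs.
  destruct (Exists_dec (fun x => 1 <= z x) l (fun x => Rle_dec 1 (z x))) as [HE|HE].
  - apply Exists_exists in HE; destruct HE as [x [Hx H1]].
    assert (1 <= Rpower (z x) b).
    { rewrite <- (Rpower_O (z x)) by lra; apply Rle_Rpower; lra. }
    pose proof (rsum_ge_term (fun x => Rpower (z x) b) l x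
                  (fun y _ => Rlt_le _ _ (Rpower_pos (z y) b)) Hx).
    simpl in *; lra.
  - eapply Rle_trans; [exact Hs|]; apply rsum_le; intros x Hx.
    apply Rpower_small; [assumption|]; split; [now apply Hz|].
    apply Rnot_lt_le; intros H; apply HE, Exists_exists; exists x; split; [assumption|lra].
Qed.

(** * Hitting times of the Push-Pull protocol *)

Definition deg (G : graph) (v : nat) : nat := length (neighbors G v).

Record wf_graph (G : graph) : Prop := {
  wf_sym : forall x y, adj G x y = adj G y x;
  wf_lt : forall x y, adj G x y = true -> (x < nv G)%nat;
  wf_deg : forall x, (x < nv G)%nat -> (0 < deg G x)%nat }.

Lemma in_vertices G x : In x (vertices G) <-> (x < nv G)%nat.
Proof. unfold vertices; rewrite in_seq; lia. Qed.

Lemma neighbors_nonempty G x : wf_graph G -> In x (vertices G) -> neighbors G x <> [].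
Proof.
  intros HG Hx E; apply in_vertices, (wf_deg G HG) in Hx.
  unfold deg in Hx; rewrite E in Hx; simpl in Hx; lia.
Qed.

Lemma contacts_is_pd G vs :
  (forall x, In x vs -> neighbors G x <> []) -> is_pd (contacts G vs).
Proof.
  induction vs as [|v vs IH]; intros H; simpl; [apply is_pd_ret|].
  apply is_pd_bind; [apply is_pd_uniform, H; now left|]; intros c _.
  apply is_pd_bind; [apply IH; intros x Hx; apply H; now right|]; intros h _.
  apply is_pd_ret.
Qed.

(** The entry drawn at the first occurrence of [x] shadows all later ones, so [c x] is a uniform
    neighbor of [x]. *)
Lemma contacts_hit G vs x y :
  (forall z, In z vs -> neighbors G z <> []) -> In x vs -> In y (neighbors G x) ->
  / INR (deg G x) <= expect (contacts G vs) (fun c => ind (Nat.eqb (c x) y)).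
Proof.
  induction vs as [|v vs IH]; intros Hne Hx Hy; [contradiction|]; simpl.
  assert (Hvs : forall z, In z vs -> neighbors G z <> []) by (intros; apply Hne; now right).
  rewrite expect_bind.
  rewrite (expect_ext _ _ (fun c => expect (contacts G vs) (fun h =>
             ind (Nat.eqb (if Nat.eqb x v then c else h x) y))))
    by (intros c _; rewrite expect_bind; apply expect_ext; intros; now rewrite expect_ret).
  destruct (Nat.eqb_spec x v) as [->|Hn].
  - rewrite (expect_ext _ _ (fun c => ind (Nat.eqb c y)))
      by (intros c _; apply expect_const; now apply contacts_is_pd).
    rewrite expect_uniform; unfold deg, Rdiv; rewrite <- (Rmult_1_l (/ _)) at 1.
    apply Rmult_le_compat_r.
    + apply Rlt_le, Rinv_0_lt_compat, lt_0_INR.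
      destruct (neighbors G v); [contradiction|simpl; lia].
    + pose proof (rsum_ge_term (fun c => ind (Nat.eqb c y)) (neighbors G v) y) as H.
      simpl in H; rewrite Nat.eqb_refl in H; apply H; [|assumption].
      intros z _; unfold ind; destruct (Nat.eqb z y); lra.
  - destruct Hx as [Hx|Hx]; [congruence|].
    rewrite expect_const by (apply is_pd_uniform, Hne; now left).
    now apply IH.
Qed.

Lemma pushpull_round_is_pd G I : wf_graph G -> is_pd (pushpull_round G I).
Proof.
  intros HG; apply is_pd_bind.
  - apply contacts_is_pd; intros; now apply neighbors_nonempty.
  - intros c _; apply is_pd_ret.
Qed.

Lemma pushpull_is_pd T G I : wf_graph G -> is_pd (pushpull T G I).
Proof.
  intros HG; revert I; induction T as [|T IH]; intros I; simpl; [apply is_pd_ret|].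
  apply is_pd_bind; [now apply pushpull_round_is_pd|]; intros; apply IH.
Qed.

Definition miss (G : graph) (b T : nat) (I : nat -> bool) : R :=
  expect (pushpull T G I) (fun J => ind (negb (J b))).

Lemma miss_succ G b T I :
  miss G b (S T) I = expect (pushpull_round G I) (miss G b T).
Proof. unfold miss; simpl; now rewrite expect_bind. Qed.

Lemma miss_le_1 G b T I : wf_graph G -> miss G b T I <= 1.
Proof.
  intros HG; rewrite <- (expect_const (pushpull T G I) 1) by now apply pushpull_is_pd.
  apply expect_le; [now apply pushpull_is_pd|].
  intros J _; unfold ind; destruct (negb (J b)); lra.
Qed.

Lemma supp_round_mono G I J x : supp (pushpull_round G I) J -> I x = true -> J x = true.
Proof.
  intros HJ Hx; apply supp_bind in HJ; destruct HJ as [c [_ HJ]].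
  apply supp_ret in HJ; subst J; now rewrite Hx.
Qed.

Lemma miss_informed G b T I : wf_graph G -> I b = true -> miss G b T I = 0.
Proof.
  intros HG; revert I; induction T as [|T IH]; intros I Hb.
  - unfold miss; simpl; rewrite expect_ret, Hb; reflexivity.
  - rewrite miss_succ, (expect_ext _ _ (fun _ => 0)).
    + now apply expect_const, pushpull_round_is_pd.
    + intros J HJ; apply IH; eapply supp_round_mono; eauto.
Qed.

(** A push from [x] to [y] has probability at least [/ deg G x], a pull by [y] from [x] at least
    [/ deg G y]. Allowing either degree lets both edges of a detour be charged to its middle
    vertex. *)
Lemma round_hit G I x y d : wf_graph G -> adj G x y = true -> d = deg G x \/ d = deg G y ->
  I x = true ->
  / INR d <= expect (pushpull_round G I) (fun J => ind (J y)).
Proof.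
  intros HG Hxy Hd HI.
  assert (Hyx : adj G y x = true) by now rewrite (wf_sym G HG).
  assert (Hx : (x < nv G)%nat) by now apply (wf_lt G HG x y).
  assert (Hy : (y < nv G)%nat) by now apply (wf_lt G HG y x).
  assert (Hne : forall z, In z (vertices G) -> neighbors G z <> [])
    by (intros; now apply neighbors_nonempty).
  unfold pushpull_round; rewrite expect_bind.
  destruct Hd as [->| ->].
  - eapply Rle_trans; [apply (contacts_hit G (vertices G) x y Hne)|].
    + now apply in_vertices.
    + apply filter_In; split; [now apply in_vertices|assumption].
    + apply expect_le; [now apply contacts_is_pd|].
      intros c _; rewrite expect_ret; unfold ind at 1.
      destruct (Nat.eqb (c x) y) eqn:E.
      * replace (existsb _ _) with true; [rewrite orb_true_r; simpl; lra|].
        symmetry; apply existsb_exists; exists x; split; [now apply in_vertices|].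
        now rewrite HI, E.
      * unfold ind; destruct (_ || _); lra.
  - eapply Rle_trans; [apply (contacts_hit G (vertices G) y x Hne)|].
    + now apply in_vertices.
    + apply filter_In; split; [now apply in_vertices|assumption].
    + apply expect_le; [now apply contacts_is_pd|].
      intros c _; rewrite expect_ret; unfold ind at 1.
      destruct (Nat.eqb_spec (c y) x) as [E|E].
      * rewrite E, HI, orb_true_r; simpl; lra.
      * unfold ind; destruct (_ || _); lra.
Qed.

(* [cheap G b x c]: the expected time for the rumor to go from x to b is at most c, in the form
   that [cheap_step] can propagate by induction on T. *)
Definition cheap (G : graph) (b x : nat) (c : R) : Prop :=
  0 <= c /\ forall T I, I x = true -> INR T * miss G b T I <= c.

Lemma cheap_refl G b : wf_graph G -> cheap G b b 0.
Proof.
  intros HG; split; [lra|]; intros T I Hb; rewrite miss_informed by assumption; lra.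
Qed.

(** While [y] is uninformed the budget is [c + INR d]; once it is informed, [c] suffices. The next
    round saves [INR d] with probability at least [/ INR d], so the expected saving is at least 1,
    which pays for that round. *)
Lemma cheap_step G b x y d c : wf_graph G -> adj G x y = true ->
  d = deg G x \/ d = deg G y ->
  cheap G b y c -> cheap G b x (c + INR d).
Proof.
  intros HG Hxy Hd [Hc Hy].
  assert (Hd0 : 0 < INR d).
  { apply lt_0_INR; destruct Hd as [->| ->]; apply wf_deg; try assumption.
    - now apply (wf_lt G HG x y).
    - apply (wf_lt G HG y x); now rewrite (wf_sym G HG). }
  split; [lra|].
  induction T as [|T IH]; intros I HI; [simpl; lra|].
  pose proof (miss_le_1 G b (S T) I HG) as H1.
  assert (H2 : INR T * miss G b (S T) I <= c + INR d - 1).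
  { rewrite miss_succ, <- expect_scal.
    apply Rle_trans with
      (* Pointwise in the outcome [J]: the hypothesis on [y] applies if [y] has been informed, the
         induction hypothesis on [T] otherwise. *)
      (expect (pushpull_round G I) (fun J => (c + INR d) + (- INR d) * ind (J y))).
    - apply expect_le; [now apply pushpull_round_is_pd|]; intros J HJ.
      unfold ind; destruct (J y) eqn:E.
      + specialize (Hy T J E); lra.
      + specialize (IH J (supp_round_mono G I J x HJ HI)); lra.
    - rewrite expect_plus, expect_const, expect_scal by now apply pushpull_round_is_pd.
      pose proof (round_hit G I x y d HG Hxy Hd HI) as H.
      apply (Rmult_le_compat_l (INR d)) in H; [|lra].
      rewrite Rinv_r in H by lra; lra. }
  rewrite S_INR; lra.
Qed.

(** * Detours *)

(* A tree edge from [src] to [dst] is crossed through a common neighbor [via]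
   (or directly, when [via = src]). *)
Record detour : Type := Detour { src : nat; dst : nat; via : nat }.

Definition crosses (G : graph) (t : detour) : Prop :=
  (via t = src t \/ adj G (src t) (via t) = true) /\ adj G (via t) (dst t) = true.

Fixpoint leads (x r : nat) (l : list detour) : Prop :=
  match l with
  | [] => x = r
  | t :: l' => src t = x /\ leads (dst t) r l'
  end.

(** The factor 2 stands for the at most two edges of a detour, each incident to [via t] and crossed
    at the price of its degree. *)
Definition toll (G : graph) (t : detour) : R := 2 * INR (deg G (via t)).

Lemma cheap_weaken G b x c c' : c <= c' -> cheap G b x c -> cheap G b x c'.
Proof.
  intros H [H0 H1]; split; [lra|]; intros T I HI; specialize (H1 T I HI); lra.
Qed.

(** The vertex [via t] pulls the rumor from [src t] and pushes it on to [dst t], so the possibly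
    huge degrees of the two ends do not enter the cost. *)
Lemma cheap_cross G b t c : wf_graph G -> crosses G t ->
  cheap G b (dst t) c -> cheap G b (src t) (c + toll G t).
Proof.
  intros HG [H1 H2] H.
  pose proof (cheap_step G b (via t) (dst t) (deg G (via t)) c HG H2 (or_introl eq_refl) H) as H3.
  unfold toll; pose proof (pos_INR (deg G (via t))).
  destruct H1 as [E|H1].
  - rewrite <- E; apply cheap_weaken with (2 := H3); lra.
  - pose proof (cheap_step G b (src t) (via t) (deg G (via t)) _ HG H1 (or_intror eq_refl) H3) as H4.
    apply cheap_weaken with (2 := H4); lra.
Qed.

Lemma cheap_cross_back G b t c : wf_graph G -> crosses G t ->
  cheap G b (src t) c -> cheap G b (dst t) (c + toll G t).
Proof.
  intros HG [H1 H2] H; rewrite (wf_sym G HG) in H2.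
  unfold toll; pose proof (pos_INR (deg G (via t))).
  destruct H1 as [E|H1].
  - rewrite <- E in H.
    pose proof (cheap_step G b (dst t) (via t) (deg G (via t)) c HG H2 (or_intror eq_refl) H) as H3.
    apply cheap_weaken with (2 := H3); lra.
  - rewrite (wf_sym G HG) in H1.
    pose proof (cheap_step G b (via t) (src t) (deg G (via t)) c HG H1 (or_introl eq_refl) H) as H3.
    pose proof (cheap_step G b (dst t) (via t) (deg G (via t)) _ HG H2 (or_intror eq_refl) H3) as H4.
    apply cheap_weaken with (2 := H4); lra.
Qed.

(** Here the rumor descends from [r] to [x] before heading for [b]. The detours are crossed
    backwards, and the induction adds them from [x] towards [r]. *)
Lemma cheap_leads_back G b r l : wf_graph G -> forall x c,
  (forall t, In t l -> crosses G t) -> leads x r l ->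
  cheap G b x c -> cheap G b r (c + rsum (toll G) l).
Proof.
  intros HG; induction l as [|t l IH]; intros x c Hl Hx Hc; simpl in Hx.
  - subst x; apply cheap_weaken with (2 := Hc); unfold rsum; simpl; lra.
  - destruct Hx as [<- Hx].
    apply cheap_weaken with ((c + toll G t) + rsum (toll G) l); [rewrite rsum_cons; lra|].
    apply IH with (dst t); [intros; apply Hl; now right|assumption|].
    apply cheap_cross_back; [assumption|apply Hl; now left|assumption].
Qed.

Lemma cheap_leads G b r l : wf_graph G -> forall x c,
  (forall t, In t l -> crosses G t) -> leads x r l ->
  cheap G b r c -> cheap G b x (c + rsum (toll G) l).
Proof.
  intros HG; induction l as [|t l IH]; intros x c Hl Hx Hc; simpl in Hx.
  - subst x; apply cheap_weaken with (2 := Hc); unfold rsum; simpl; lra.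
  - destruct Hx as [<- Hx].
    apply cheap_weaken with ((c + rsum (toll G) l) + toll G t); [rewrite rsum_cons; lra|].
    apply cheap_cross; [assumption|apply Hl; now left|].
    apply IH; [intros; apply Hl; now right|assumption|assumption].
Qed.

(** The rumor climbs from [x] to [r] along [lx] and descends to [b] along [lb]. Dividing the total
    toll by [T] gives a Markov-type bound; combined with the trivial bound 1, it becomes a sum of
    [beta]-th powers through [min_one_sum_le_sum_Rpower]. *)
Lemma miss_le_tolls G b x r lb lx T I beta : wf_graph G -> (0 < T)%nat -> 0 < beta < 1 ->
  (forall t, In t lb -> crosses G t) -> (forall t, In t lx -> crosses G t) ->
  (forall t, In t lb \/ In t lx -> (0 < deg G (via t))%nat) ->
  leads b r lb -> leads x r lx -> I x = true ->
  miss G b T I <= Rpower (2 / INR T) beta *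
    (rsum (fun t => Rpower (INR (deg G (via t))) beta) lb +
     rsum (fun t => Rpower (INR (deg G (via t))) beta) lx).
Proof.
  intros HG HT Hbeta Hlb Hlx Hdeg Hb Hx HI.
  assert (HT' : 0 < INR T) by now apply lt_0_INR.
  assert (H2T : 0 < 2 / INR T) by (apply Rdiv_lt_0_compat; lra).
  pose proof (cheap_leads_back G b r lb HG b 0 Hlb Hb (cheap_refl G b HG)) as Hr.
  pose proof (cheap_leads G b r lx HG x _ Hlx Hx Hr) as [_ H]; specialize (H T I HI).
  rewrite Rplus_0_l, <- rsum_app in H.
  rewrite <- rsum_app, <- rsum_scal.
  assert (Hpos : forall t, In t (lb ++ lx) -> 0 < INR (deg G (via t))).
  { intros t Ht; apply lt_0_INR, Hdeg; now apply in_app_or. }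
  rewrite (rsum_ext _ (fun t => Rpower (2 / INR T * INR (deg G (via t))) beta))
    by (intros t Ht; apply Rpower_mult_distr; [assumption|now apply Hpos]).
  apply min_one_sum_le_sum_Rpower; [assumption| |now apply miss_le_1|].
  - intros t Ht; apply Rmult_lt_0_compat; [assumption|now apply Hpos].
  - apply Rmult_le_reg_l with (INR T); [assumption|].
    eapply Rle_trans; [exact H|]; rewrite <- rsum_scal.
    apply rsum_le; intros t _; unfold toll; apply Req_le; field; lra.
Qed.

(** * Cliques of random k-trees *)

(** Written so as to coincide with the adjacency test inside [attach]. *)
Definition mem (x : nat) (K : list nat) : bool := existsb (Nat.eqb x) K.

Lemma memP x K : reflect (In x K) (mem x K).
Proof.
  apply iff_reflect; unfold mem; rewrite existsb_exists; split.
  - intros H; exists x; split; [assumption|apply Nat.eqb_refl].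
  - intros [y [Hy E]]; apply Nat.eqb_eq in E; now subst.
Qed.

Lemma ind_nonneg b : 0 <= ind b.
Proof. destruct b; unfold ind; lra. Qed.

Lemma choose_In j l c : In c (choose j l) -> length c = j /\ incl c l.
Proof.
  revert j c; induction l as [|x l IH]; intros [|j] c H; simpl in H.
  - destruct H as [<-|[]]; split; [reflexivity|apply incl_nil_l].
  - contradiction.
  - destruct H as [<-|[]]; split; [reflexivity|apply incl_nil_l].
  - apply in_app_or in H; destruct H as [H|H].
    + apply in_map_iff in H; destruct H as [c' [<- H]]; apply IH in H as [<- H].
      split; [reflexivity|]; apply incl_cons; [now left|now apply incl_tl].
    + apply IH in H as [<- H]; split; [reflexivity|now apply incl_tl].
Qed.

Lemma choose_0 l : choose 0 l = [[]].
Proof. now destruct l. Qed.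

Lemma choose_cons j x l : choose (S j) (x :: l) = map (cons x) (choose j l) ++ choose (S j) l.
Proof. reflexivity. Qed.

Lemma choose_short j l : (length l < j)%nat -> choose j l = [].
Proof.
  revert j; induction l as [|x l IH]; intros [|j] H; simpl in *; try lia; [reflexivity|].
  rewrite !IH by lia; reflexivity.
Qed.

Lemma choose_full l : choose (length l) l = [l].
Proof.
  induction l as [|x l IH]; [reflexivity|].
  simpl; rewrite IH, choose_short by lia; reflexivity.
Qed.

Lemma choose_filter p j l : choose j (filter p l) = filter (forallb p) (choose j l).
Proof.
  revert j; induction l as [|x l IH]; intros [|j]; try reflexivity.
  - now rewrite !choose_0.
  - simpl; rewrite filter_app, filter_map_swap.
    destruct (p x) eqn:E; simpl.
    + rewrite !IH, E; reflexivity.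
    + rewrite E; simpl; rewrite filter_false; apply IH.
Qed.

Lemma choose_NoDup j l c : NoDup l -> In c (choose j l) -> NoDup c.
Proof.
  intros Hl; revert j c; induction Hl as [|x l Hx Hl IH]; intros [|j] c H; simpl in H.
  - destruct H as [<-|[]]; constructor.
  - contradiction.
  - destruct H as [<-|[]]; constructor.
  - apply in_app_or in H; destruct H as [H|H]; [|now apply (IH (S j))].
    apply in_map_iff in H; destruct H as [c' [<- H]]; constructor; [|now apply (IH j)].
    intros Hc; apply choose_In in H; apply Hx, H, Hc.
Qed.

(** [choose] keeps the order of [l], so over a duplicate-free list a chosen sublist is determined by
    its set of members. *)
Lemma choose_filter_mem j l c : NoDup l -> In c (choose j l) ->
  filter (fun x => mem x c) l = c.
Proof.
  intros Hl; revert j c; induction Hl as [|x l Hx Hl IH]; intros [|j] c H; simpl in H.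
  - destruct H as [<-|[]]; reflexivity.
  - contradiction.
  - destruct H as [<-|[]]; simpl; now rewrite filter_false.
  - apply in_app_or in H; destruct H as [H|H].
    + apply in_map_iff in H; destruct H as [c' [<- H]]; simpl; rewrite Nat.eqb_refl; simpl.
      f_equal; etransitivity; [|now apply (IH j)].
      apply filter_ext_in; intros y Hy; destruct (Nat.eqb_spec y x); [congruence|reflexivity].
    + simpl; destruct (memP x c) as [Hc|Hc].
      * apply choose_In in H; now apply H in Hc.
      * now apply (IH (S j)).
Qed.

(** Pascal's rule at the end of the list, where [attach] puts the new vertex, whereas [choose]
    recurses at the front. It is stated for sums because the two sides enumerate the subsets in
    different orders. *)
Lemma rsum_choose_snoc (F : list nat -> R) j l x :
  rsum F (choose (S j) (l ++ [x])) =
  rsum F (choose (S j) l) + rsum (fun c => F (c ++ [x])) (choose j l).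
Proof.
  revert j F; induction l as [|y l IH]; intros j F.
  - destruct j; unfold rsum; simpl; ring.
  - change ((y :: l) ++ [x]) with (y :: (l ++ [x])).
    rewrite !choose_cons, !rsum_app, !rsum_map, IH.
    destruct j as [|j].
    + rewrite !choose_0; unfold rsum; simpl; ring.
    + rewrite IH, choose_cons, rsum_app, rsum_map; simpl; ring.
Qed.

Lemma choose_pred_length j l : length l = S j -> rsum (fun _ => 1) (choose j l) = INR (S j).
Proof.
  revert j; induction l as [|x l IH]; intros j H; simpl in H; [lia|].
  destruct j as [|j]; [unfold rsum; simpl; ring|].
  rewrite choose_cons, rsum_app, rsum_map, IH by lia.
  replace (S j) with (length l) at 2 by lia; rewrite choose_full.
  unfold rsum; simpl length; simpl fold_right; rewrite (S_INR (S j)); ring.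
Qed.

(** Exactly one of the [S j] subsets of size [j] omits [a]. *)
Lemma choose_pred_mem j l a : NoDup l -> length l = S j -> In a l ->
  rsum (fun c => ind (mem a c)) (choose j l) = INR j.
Proof.
  intros Hl; revert j; induction Hl as [|x l Hx Hl IH]; intros j H Ha; simpl in H; [lia|].
  destruct j as [|j]; [unfold rsum; simpl; ring|].
  rewrite choose_cons, rsum_app, rsum_map.
  replace (S j) with (length l) at 1 by lia; rewrite choose_full, rsum_cons.
  change (rsum _ []) with 0; simpl mem.
  destruct Ha as [->|Ha].
  - rewrite Nat.eqb_refl; simpl.
    rewrite (choose_pred_length j l) by lia.
    destruct (memP a l); [contradiction|simpl; ring].
  - rewrite (rsum_ext _ (fun c => ind (mem a c))).
    + rewrite IH, S_INR by (assumption || lia).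
      destruct (memP a l); [simpl; ring|contradiction].
    + intros c _; destruct (Nat.eqb_spec a x); [congruence|reflexivity].
Qed.

(** * Degrees and cliques after attaching one vertex *)

Lemma vertices_attach G K : vertices (attach G K) = vertices G ++ [nv G].
Proof. apply seq_S. Qed.

Section Attach.

Variables (j : nat) (G : graph) (K : list nat).
Hypothesis HG : wf_graph G.
Hypothesis HK : In K (kcliques (S j) G).

Let v := nv G.

Lemma kclique_props : length K = S j /\ NoDup K /\ (forall x, In x K -> (x < v)%nat) /\
  filter (fun x => mem x K) (vertices G) = K /\ is_clique G K = true.
Proof.
  unfold kcliques in HK; apply filter_In in HK as [H1 H2].
  pose proof (choose_In _ _ _ H1) as [H3 H4].
  assert (Hn : NoDup (vertices G)) by apply seq_NoDup.
  repeat split; try assumption.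
  - now apply (choose_NoDup _ _ _ Hn H1).
  - intros x Hx; now apply in_vertices, H4.
  - now apply (choose_filter_mem _ _ _ Hn H1).
Qed.

Lemma adj_ge_nv x y : (v <= x)%nat -> adj G x y = false.
Proof.
  intros H; destruct (adj G x y) eqn:E; [|reflexivity].
  apply (wf_lt G HG) in E; unfold v in H; lia.
Qed.

Lemma adj_attach_old x y : (x < v)%nat -> (y < v)%nat -> adj (attach G K) x y = adj G x y.
Proof.
  intros Hx Hy; simpl; fold v.
  replace (Nat.eqb x v) with false by (symmetry; apply Nat.eqb_neq; lia).
  replace (Nat.eqb y v) with false by (symmetry; apply Nat.eqb_neq; lia).
  now rewrite !orb_false_r.
Qed.

Lemma adj_attach_new x : (x < v)%nat -> adj (attach G K) x v = mem x K.
Proof.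
  intros Hx; simpl; fold v; rewrite Nat.eqb_refl, (wf_sym G HG), adj_ge_nv by lia.
  replace (Nat.eqb x v) with false by (symmetry; apply Nat.eqb_neq; lia).
  reflexivity.
Qed.

Lemma adj_attach_sym x y : adj (attach G K) x y = adj (attach G K) y x.
Proof.
  simpl; rewrite (wf_sym G HG x y), <- !orb_assoc; f_equal; apply orb_comm.
Qed.

Lemma adj_attach_lt x y : adj (attach G K) x y = true -> (x < S v)%nat.
Proof.
  destruct kclique_props as [_ [_ [HKv _]]].
  simpl; fold v; rewrite !orb_true_iff, !andb_true_iff, !Nat.eqb_eq.
  intros [[H|[-> _]]|[_ H]]; [|lia|].
  - apply (wf_lt G HG) in H; unfold v; lia.
  - apply (reflect_iff _ _ (memP x K)), HKv in H; lia.
Qed.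

Lemma adj_attach_mono x y : adj G x y = true -> adj (attach G K) x y = true.
Proof. intros H; simpl; now rewrite H. Qed.

Lemma deg_attach_old x : (x < v)%nat ->
  deg (attach G K) x = (deg G x + if mem x K then 1 else 0)%nat.
Proof.
  intros Hx; unfold deg, neighbors.
  rewrite vertices_attach, filter_app, length_app; f_equal.
  - f_equal; apply filter_ext_in; intros y Hy; apply in_vertices in Hy.
    now apply adj_attach_old.
  - cbn [filter]; fold v; rewrite adj_attach_new by assumption; now destruct (mem x K).
Qed.

Lemma deg_attach_new : deg (attach G K) v = S j.
Proof.
  destruct kclique_props as [Hl [_ [HKv [Hf _]]]].
  unfold deg, neighbors.
  rewrite vertices_attach, filter_app, length_app; fold v.
  replace (filter (adj (attach G K) v) (vertices G)) with K.
  - cbn [filter].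
    assert (E : adj (attach G K) v v = false).
    { simpl; fold v; rewrite adj_ge_nv, Nat.eqb_refl by lia; simpl.
      fold (mem v K); destruct (memP v K) as [H|H]; [apply HKv in H; lia|reflexivity]. }
    rewrite E; simpl; lia.
  - rewrite <- Hf at 1; apply filter_ext_in; intros x Hx; apply in_vertices in Hx.
    rewrite adj_attach_sym; symmetry; now apply adj_attach_new.
Qed.

Lemma attach_wf : wf_graph (attach G K).
Proof.
  split.
  - apply adj_attach_sym.
  - apply adj_attach_lt.
  - intros x Hx; simpl in Hx; fold v in Hx.
    destruct (Nat.eq_dec x v) as [->|Hn].
    + rewrite deg_attach_new; lia.
    + rewrite deg_attach_old by lia.
      assert (0 < deg G x)%nat by (apply (wf_deg G HG); fold v; lia); lia.
Qed.

(** The old neighbors of [v] are exactly the members of [K], and these are pairwise adjacent. *)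
Lemma forallb_mem_clique c : (forall x, In x c -> (x < v)%nat) ->
  is_clique (attach G K) (c ++ [v]) = forallb (fun x => mem x K) c.
Proof.
  destruct kclique_props as [_ [_ [HKv [_ Hcl]]]].
  intros Hc; apply eq_true_iff_eq; unfold is_clique in *; rewrite !forallb_forall; split.
  - intros H x Hx; specialize (H x (in_or_app _ _ _ (or_introl Hx))).
    rewrite forallb_forall in H; specialize (H v (in_or_app _ _ _ (or_intror (in_eq _ _)))).
    apply Hc in Hx; apply orb_true_iff in H; destruct H as [H|H].
    + apply Nat.eqb_eq in H; lia.
    + now rewrite adj_attach_new in H.
  - intros H x Hx; rewrite forallb_forall; intros y Hy.
    rewrite forallb_forall in Hcl.
    apply in_app_or in Hx; apply in_app_or in Hy; simpl in Hx, Hy.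
    destruct Hx as [Hx|[<-|[]]], Hy as [Hy|[<-|[]]].
    + rewrite adj_attach_old by now apply Hc.
      apply H in Hx; apply H in Hy.
      apply (reflect_iff _ _ (memP x K)) in Hx; apply (reflect_iff _ _ (memP y K)) in Hy.
      specialize (Hcl x Hx); rewrite forallb_forall in Hcl; now apply Hcl.
    + rewrite adj_attach_new by (now apply Hc); rewrite (H x Hx); apply orb_true_r.
    + rewrite adj_attach_sym, adj_attach_new by (now apply Hc); rewrite (H y Hy); apply orb_true_r.
    + now rewrite Nat.eqb_refl.
Qed.

(** A candidate without [v] is a clique exactly when it was one before; a candidate [c ++ [v]] is
    one exactly when [c] lies inside [K]. Since [v] stands last, [last] returns the youngest vertex
    of every new clique. *)
Lemma rsum_kcliques_attach (F : list nat -> R) :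
  rsum F (kcliques (S j) (attach G K)) =
  rsum F (kcliques (S j) G) + rsum (fun c => F (c ++ [v])) (choose j K).
Proof.
  destruct kclique_props as [_ [_ [_ [Hf _]]]].
  unfold kcliques; rewrite !rsum_filter, vertices_attach, rsum_choose_snoc; fold v; f_equal.
  - apply rsum_ext; intros c Hc; apply choose_In in Hc as [_ Hc]; do 2 f_equal.
    assert (Hcv : forall x, In x c -> (x < v)%nat) by (intros x Hx; now apply Hc, in_vertices in Hx).
    apply eq_true_iff_eq; unfold is_clique; rewrite !forallb_forall.
    split; intros H x Hx; specialize (H x Hx); rewrite forallb_forall in *; intros y Hy;
      specialize (H y Hy); rewrite adj_attach_old in * by (now apply Hcv); assumption.
  - assert (E : choose j K = filter (forallb (fun x => mem x K)) (choose j (vertices G)))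
      by now rewrite <- choose_filter, Hf.
    rewrite E, rsum_filter.
    apply rsum_ext; intros c Hc; apply choose_In in Hc as [_ Hc].
    rewrite forallb_mem_clique; [reflexivity|].
    intros x Hx; now apply Hc, in_vertices in Hx.
Qed.

End Attach.

(* [kt_own]: at most k cliques have a given vertex as their youngest element. *)
Record ktree (k n : nat) (G : graph) : Prop := {
  kt_wf : wf_graph G;
  kt_nv : nv G = (n + k)%nat;
  kt_num : rsum (fun _ => 1) (kcliques k G) = INR k * INR n + 1;
  kt_mem : forall w, (w < nv G)%nat ->
    rsum (fun K => ind (mem w K)) (kcliques k G) <= (INR k - 1) * INR (deg G w);
  kt_own : forall F : nat -> R, (forall x, 0 <= F x) ->
    rsum (fun K => F (last K 0%nat)) (kcliques k G) <= INR k * rsum F (vertices G) }.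

Lemma mem_snoc x c y : mem x (c ++ [y]) = mem x c || Nat.eqb x y.
Proof. unfold mem; rewrite existsb_app; simpl; now rewrite orb_false_r. Qed.

Lemma mem_choose_false j K c v : ~ In v K -> In c (choose j K) -> mem v c = false.
Proof.
  intros Hv Hc; destruct (memP v c) as [H|H]; [|reflexivity].
  apply choose_In in Hc; now apply Hc in H.
Qed.

(** Each step creates k cliques, all with the new vertex as youngest. A vertex of [K] gains one
    neighbor and k-1 cliques; the new vertex has degree k and lies in k cliques, which is at most
    (k-1)k because k is at least 2. *)
Lemma attach_ktree k n G K : (2 <= k)%nat -> ktree k n G -> In K (kcliques k G) ->
  ktree k (S n) (attach G K).
Proof.
  destruct k as [|j]; [lia|]; intros Hk HT HK.
  pose proof (kt_wf _ _ _ HT) as HG.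
  destruct (kclique_props j G K HK) as [Hl [Hnd [HKv _]]].
  assert (HvK : ~ In (nv G) K) by (intros H; apply HKv in H; lia).
  assert (Hj : 1 <= INR j) by (apply (le_INR 1); lia).
  split.
  - now apply (attach_wf j).
  - simpl; now rewrite (kt_nv _ _ _ HT).
  - rewrite rsum_kcliques_attach, (kt_num _ _ _ HT), choose_pred_length, !S_INR by assumption.
    ring.
  - intros w Hw; rewrite rsum_kcliques_attach by assumption; simpl in Hw.
    rewrite S_INR; replace (INR j + 1 - 1) with (INR j) by ring.
    destruct (Nat.eq_dec w (nv G)) as [->|Hn].
    + rewrite (deg_attach_new j) by assumption.
      rewrite (rsum_ext _ (fun _ => 0)).
      * rewrite rsum_const, (rsum_ext _ (fun _ => 1)).
        -- rewrite choose_pred_length by assumption; pose proof (pos_INR (S j)); nra.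
        -- intros c _; now rewrite mem_snoc, Nat.eqb_refl, orb_true_r.
      * intros c Hc; destruct (kclique_props j G c Hc) as [_ [_ [Hcv _]]].
        destruct (memP (nv G) c) as [H|H]; [apply Hcv in H; lia|reflexivity].
    + pose proof (kt_mem _ _ _ HT w) as H; rewrite S_INR in H.
      rewrite (deg_attach_old G K HG) by lia; rewrite plus_INR.
      rewrite (rsum_ext (fun c => ind (mem w (c ++ [nv G]))) (fun c => ind (mem w c))).
      * specialize (H ltac:(lia)); destruct (memP w K) as [Hw'|Hw'].
        -- rewrite choose_pred_mem by assumption; simpl INR; lra.
        -- assert (E : rsum (fun c => ind (mem w c)) (choose j K) = 0).
           { rewrite (rsum_ext _ (fun _ => 0)), rsum_const; [ring|].
             intros c Hc; now rewrite (mem_choose_false j K). }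
           rewrite E; simpl INR; lra.
      * intros c _; rewrite mem_snoc.
        replace (Nat.eqb w (nv G)) with false by (symmetry; now apply Nat.eqb_neq).
        now rewrite orb_false_r.
  - intros F HF; rewrite rsum_kcliques_attach by assumption.
    pose proof (kt_own _ _ _ HT F HF) as H.
    rewrite vertices_attach, rsum_app.
    rewrite (rsum_ext (fun c => F (last (c ++ [nv G]) 0%nat)) (fun _ => F (nv G) * 1))
      by (intros c _; rewrite last_last; ring).
    rewrite rsum_scal, choose_pred_length by assumption.
    change (rsum F [nv G]) with (F (nv G) + 0).
    lra.
Qed.

Lemma kcliques_clique_graph k : kcliques k (clique_graph k) = [seq 0 k].
Proof.
  unfold kcliques, vertices; simpl nv.
  rewrite <- (length_seq k 0) at 2; rewrite choose_full; cbn [filter].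
  replace (is_clique _ _) with true; [reflexivity|].
  symmetry; unfold is_clique; apply forallb_forall; intros x Hx.
  apply forallb_forall; intros y Hy; apply in_seq in Hx; apply in_seq in Hy; simpl.
  replace (Nat.ltb x k) with true by (symmetry; apply Nat.ltb_lt; lia).
  replace (Nat.ltb y k) with true by (symmetry; apply Nat.ltb_lt; lia).
  now destruct (Nat.eqb x y).
Qed.

Lemma deg_clique_graph k x : (x < k)%nat -> deg (clique_graph k) x = (k - 1)%nat.
Proof.
  intros Hx; unfold deg, neighbors, vertices; simpl nv.
  replace k with (x + S (k - 1 - x))%nat at 2 by lia.
  rewrite seq_app, filter_app, length_app; simpl seq; cbn [filter].
  replace (adj (clique_graph k) x x) with false by (simpl; now rewrite Nat.eqb_refl).
  rewrite !forallb_filter_id; [rewrite !length_seq; lia| |];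
    apply forallb_forall; intros y Hy; apply in_seq in Hy; simpl;
    replace (Nat.ltb x k) with true by (symmetry; apply Nat.ltb_lt; lia);
    replace (Nat.ltb y k) with true by (symmetry; apply Nat.ltb_lt; lia);
    replace (Nat.eqb x y) with false by (symmetry; apply Nat.eqb_neq; lia);
    reflexivity.
Qed.

Lemma clique_graph_ktree k : (2 <= k)%nat -> ktree k 0 (clique_graph k).
Proof.
  intros Hk; assert (Hk' : 2 <= INR k) by (apply (le_INR 2); lia).
  split; [split| | | |].
  - intros x y; simpl; rewrite (Nat.eqb_sym x y).
    now destruct (Nat.eqb y x), (Nat.ltb x k), (Nat.ltb y k).
  - intros x y; simpl; rewrite !andb_true_iff, !Nat.ltb_lt; tauto.
  - intros x Hx; simpl in Hx; rewrite deg_clique_graph; lia.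
  - reflexivity.
  - rewrite kcliques_clique_graph; unfold rsum; simpl; ring.
  - intros w Hw; simpl in Hw; rewrite kcliques_clique_graph, deg_clique_graph by assumption.
    rewrite minus_INR by lia; simpl INR; unfold rsum; simpl.
    unfold ind; destruct (mem _ _); nra.
  - intros F HF; rewrite kcliques_clique_graph; change (rsum ?f [?a]) with (f a + 0); cbv beta.
    assert (Hl : In (last (seq 0 k) 0%nat) (vertices (clique_graph k))).
    { apply in_vertices; simpl; destruct k as [|k]; [lia|].
      rewrite seq_S, last_last; lia. }
    pose proof (rsum_ge_term F _ _ (fun y _ => HF y) Hl).
    pose proof (HF (last (seq 0 k) 0%nat)).
    nra.
Qed.

Lemma ktree_kcliques_nonempty k n G : ktree k n G -> kcliques k G <> [].
Proof.
  intros HT E; pose proof (kt_num _ _ _ HT) as H; rewrite E in H; unfold rsum in H; simpl in H.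
  pose proof (pos_INR k); pose proof (pos_INR n); nra.
Qed.

(** * Paths to the root and their evolution *)

(** When the chosen clique contains both ends, the new vertex is adjacent to both and has degree k
    only, so it takes over as the middle vertex. *)
Definition refresh (K : list nat) (v : nat) (t : detour) : detour :=
  if mem (src t) K && mem (dst t) K then Detour (src t) (dst t) v else t.

Definition state : Type := graph * (nat -> list detour).

(* The second component gives each vertex a path of detours to the root, which is the vertex [k],
   the first one attached to the initial clique. *)
Definition grow (s : state) (K : list nat) : state :=
  let v := nv (fst s) in
  let m := last K 0%nat in
  (attach (fst s) K,
   fun x => map (refresh K v) (if Nat.eqb x v then Detour v m v :: snd s m else snd s x)).

(** This is the situation in G(1). In G(0) all degrees are k-1, so the bound [sd_deg] required below
    is available only after the first attachment. *)
Definition start (k : nat) : state :=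
  (attach (clique_graph k) (seq 0 k), fun x => if Nat.ltb x k then [Detour x k x] else []).

Fixpoint aug (k n : nat) : dist state :=
  match n with
  | 0%nat => dret (start k)
  | S n' => dbind (aug k n') (fun s =>
              dbind (uniform (kcliques k (fst s))) (fun K => dret (grow s K)))
  end.

(** G(0) has a single k-clique, so G(1) is deterministic and [aug] can start there, one step ahead.
    The paths are determined by the successive choices of cliques; forgetting them leaves the graph
    process. *)
Lemma expect_aug k n (F : graph -> R) :
  expect (random_ktree k (S n)) F = expect (aug k n) (fun s => F (fst s)).
Proof.
  revert F; induction n as [|n IH]; intros F.
  - change (random_ktree k 1) with (dbind (dret (clique_graph k)) (ktree_step k)).
    change (aug k 0) with (dret (start k)); unfold ktree_step.
    rewrite expect_bind, !expect_ret, expect_bind, kcliques_clique_graph, expect_uniform.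
    rewrite rsum_cons, expect_ret; change (rsum _ []) with 0; simpl INR.
    change (fst (start k)) with (attach (clique_graph k) (seq 0 k)); field.
  - change (random_ktree k (S (S n))) with (dbind (random_ktree k (S n)) (ktree_step k)).
    change (aug k (S n)) with (dbind (aug k n) (fun s =>
      dbind (uniform (kcliques k (fst s))) (fun K => dret (grow s K)))).
    rewrite !expect_bind, IH.
    apply expect_ext; intros s _; unfold ktree_step; rewrite !expect_bind.
    apply expect_ext; intros K _; now rewrite !expect_ret.
Qed.

(** [sd_pair] yields the probability of rerouting, at least (k-1)/N with N cliques; [sd_deg] ensures
    that rerouting never increases the degree of the middle vertex. *)
Record sound (k : nat) (G : graph) (t : detour) : Prop := {
  sd_crosses : crosses G t;
  sd_src : (src t < nv G)%nat;
  sd_dst : (dst t < nv G)%nat;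
  sd_via : (via t < nv G)%nat;
  sd_deg : (k <= deg G (via t))%nat;
  sd_pair : INR k - 1 <= rsum (fun K => ind (mem (src t) K && mem (dst t) K)) (kcliques k G) }.

Record valid (k n : nat) (s : state) : Prop := {
  vd_ktree : ktree k (S n) (fst s);
  vd_sound : forall x, (x < nv (fst s))%nat -> forall t, In t (snd s x) -> sound k (fst s) t;
  vd_leads : forall x, (x < nv (fst s))%nat -> leads x k (snd s x) }.

Lemma kcliques_pair_mono j G K a b : wf_graph G -> In K (kcliques (S j) G) ->
  rsum (fun c => ind (mem a c && mem b c)) (kcliques (S j) G) <=
  rsum (fun c => ind (mem a c && mem b c)) (kcliques (S j) (attach G K)).
Proof.
  intros HG HK; rewrite rsum_kcliques_attach by assumption.
  enough (0 <= rsum (fun c => ind (mem a (c ++ [nv G]) && mem b (c ++ [nv G]))) (choose j K))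
    by lra.
  apply rsum_nonneg; intros; apply ind_nonneg.
Qed.

(** Of the [S j] cliques created together with the new vertex, only one omits [m]. *)
Lemma kcliques_pair_new j G K m : wf_graph G -> In K (kcliques (S j) G) -> In m K ->
  INR j <= rsum (fun c => ind (mem m c && mem (nv G) c)) (kcliques (S j) (attach G K)).
Proof.
  intros HG HK Hm; rewrite rsum_kcliques_attach by assumption.
  destruct (kclique_props j G K HK) as [Hl [Hnd [HKv _]]].
  rewrite (rsum_ext (fun c => ind (mem m (c ++ [nv G]) && mem (nv G) (c ++ [nv G])))
             (fun c => ind (mem m c))).
  - rewrite choose_pred_mem by assumption.
    enough (0 <= rsum (fun c => ind (mem m c && mem (nv G) c)) (kcliques (S j) G)) by lra.
    apply rsum_nonneg; intros; apply ind_nonneg.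
  - intros c _; rewrite !mem_snoc, Nat.eqb_refl, orb_true_r, andb_true_r.
    replace (Nat.eqb m (nv G)) with false
      by (symmetry; apply Nat.eqb_neq; apply HKv in Hm; lia).
    now rewrite orb_false_r.
Qed.

Lemma refresh_sound k G K t : wf_graph G -> In K (kcliques k G) -> (0 < k)%nat ->
  sound k G t -> sound k (attach G K) (refresh K (nv G) t).
Proof.
  destruct k as [|j]; [lia|]; intros HG HK _ [H1 H2 H3 H4 H5 H6].
  pose proof (kcliques_pair_mono j G K (src t) (dst t) HG HK) as H7.
  unfold refresh; destruct (mem (src t) K && mem (dst t) K) eqn:E.
  - apply andb_true_iff in E as [Es Ed].
    split; simpl src; simpl dst; simpl via; try (simpl; lia); try lra.
    + split; [right|]; simpl src; simpl dst; simpl via.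
      * now rewrite adj_attach_new.
      * rewrite adj_attach_sym by assumption; now rewrite adj_attach_new.
    + rewrite (deg_attach_new j) by assumption; lia.
  - split; try (simpl; lia); try lra.
    + destruct H1 as [[H1|H1] H8]; split; try (now apply adj_attach_mono); [now left|right].
      now apply adj_attach_mono.
    + rewrite deg_attach_old by assumption; lia.
Qed.

Lemma new_detour_sound k G K m : wf_graph G -> In K (kcliques k G) -> (0 < k)%nat -> In m K ->
  sound k (attach G K) (Detour (nv G) m (nv G)).
Proof.
  destruct k as [|j]; [lia|]; intros HG HK _ Hm.
  destruct (kclique_props j G K HK) as [_ [_ [HKv _]]].
  specialize (HKv m Hm).
  split; simpl src; simpl dst; simpl via; try (simpl; lia).
  - split; [now left|]; simpl via; simpl dst.
    rewrite adj_attach_sym, adj_attach_new by assumption.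
    now destruct (memP m K).
  - rewrite (deg_attach_new j) by assumption; lia.
  - rewrite S_INR; pose proof (kcliques_pair_new j G K m HG HK Hm) as H.
    rewrite (rsum_ext _ (fun c => ind (mem m c && mem (nv G) c)))
      by (intros; now rewrite andb_comm).
    lra.
Qed.

Lemma last_In (l : list nat) : l <> [] -> In (last l 0%nat) l.
Proof.
  intros H; destruct (exists_last H) as [l' [x ->]]; rewrite last_last.
  apply in_or_app; right; now left.
Qed.

Lemma kclique_last k G K : (0 < k)%nat -> In K (kcliques k G) -> In (last K 0%nat) K.
Proof.
  destruct k as [|j]; [lia|]; intros _ HK; apply last_In; intros ->.
  destruct (kclique_props j G [] HK) as [H _]; discriminate H.
Qed.

Lemma leads_refresh K v l : forall x r, leads x r l -> leads x r (map (refresh K v) l).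
Proof.
  induction l as [|t l IH]; intros x r H; [exact H|].
  destruct H as [H1 H2]; split.
  - rewrite <- H1; unfold refresh; destruct (_ && _); reflexivity.
  - replace (dst (refresh K v t)) with (dst t); [now apply IH|].
    unfold refresh; destruct (_ && _); reflexivity.
Qed.

(** The new vertex lies outside [K], so refreshing leaves its own first detour unchanged. *)
Lemma grow_new_path k G (p : nat -> list detour) K : (0 < k)%nat -> In K (kcliques k G) ->
  let v := nv G in let m := last K 0%nat in
  snd (grow (G, p) K) v = Detour v m v :: map (refresh K v) (p m).
Proof.
  destruct k as [|j]; [lia|]; intros _ HK; cbv zeta.
  destruct (kclique_props j G K HK) as [_ [_ [HKv _]]].
  simpl; rewrite Nat.eqb_refl; simpl; unfold refresh at 1; simpl src.
  destruct (memP (nv G) K) as [H|H]; [apply HKv in H; lia|reflexivity].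
Qed.

Lemma grow_old_path G (p : nat -> list detour) K x : (x < nv G)%nat ->
  snd (grow (G, p) K) x = map (refresh K (nv G)) (p x).
Proof.
  intros Hx; simpl.
  replace (Nat.eqb x (nv G)) with false by (symmetry; apply Nat.eqb_neq; lia); reflexivity.
Qed.

Lemma grow_valid k n s K : (2 <= k)%nat -> valid k n s -> In K (kcliques k (fst s)) ->
  valid k (S n) (grow s K).
Proof.
  destruct s as [G p]; intros Hk [HT Hs Hl] HK; simpl fst in *; simpl snd in *.
  pose proof (kt_wf _ _ _ HT) as HG.
  pose proof (kclique_last k G K ltac:(lia) HK) as Hm.
  assert (Hmv : (last K 0 < nv G)%nat).
  { destruct k as [|j]; [lia|].
    destruct (kclique_props j G K HK) as [_ [_ [HKv _]]]; now apply HKv. }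
  split; simpl fst.
  - now apply attach_ktree.
  - intros x Hx t Ht; simpl in Hx; destruct (Nat.eq_dec x (nv G)) as [->|Hn].
    + rewrite (grow_new_path k) in Ht by (assumption || lia); destruct Ht as [<-|Ht].
      * apply new_detour_sound; (assumption || lia).
      * apply in_map_iff in Ht as [t' [<- Ht]].
        apply refresh_sound; try (assumption || lia); now apply (Hs (last K 0%nat)).
    + rewrite grow_old_path in Ht by lia; apply in_map_iff in Ht as [t' [<- Ht]].
      apply refresh_sound; try (assumption || lia); apply (Hs x); [lia|assumption].
  - intros x Hx; simpl in Hx; destruct (Nat.eq_dec x (nv G)) as [->|Hn].
    + rewrite (grow_new_path k) by (assumption || lia); split; [reflexivity|].
      now apply leads_refresh, Hl.
    + rewrite grow_old_path by lia; apply leads_refresh, Hl; lia.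
Qed.

Lemma start_valid k : (2 <= k)%nat -> valid k 0 (start k).
Proof.
  intros Hk; pose proof (clique_graph_ktree k Hk) as HT.
  assert (HK : In (seq 0 k) (kcliques k (clique_graph k)))
    by (rewrite kcliques_clique_graph; now left).
  pose proof (kt_wf _ _ _ HT) as HG.
  split; simpl fst.
  - now apply attach_ktree.
  - intros x Hx t; simpl in Hx; unfold start; simpl snd.
    destruct (Nat.ltb_spec x k) as [H|H]; [|contradiction].
    intros [<-|[]].
    assert (Hxk : mem x (seq 0 k) = true)
      by (apply (reflect_iff _ _ (memP x _)), in_seq; lia).
    split; simpl src; simpl dst; simpl via; try (simpl; lia).
    + split; [now left|]; simpl via; simpl dst.
      change k with (nv (clique_graph k)) at 3; now rewrite adj_attach_new.
    + rewrite deg_attach_old, Hxk, deg_clique_graph by assumption; lia.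
    + destruct k as [|j]; [lia|].
      pose proof (kcliques_pair_new j (clique_graph (S j)) _ x HG HK) as Hp.
      rewrite S_INR; replace (INR j + 1 - 1) with (INR j) by ring; apply Hp, in_seq; lia.
  - intros x Hx; simpl in Hx; simpl snd.
    destruct (Nat.ltb_spec x k); simpl; [tauto|lia].
Qed.

Lemma aug_valid k n s : (2 <= k)%nat -> supp (aug k n) s -> valid k n s.
Proof.
  intros Hk; revert s; induction n as [|n IH]; intros s Hs.
  - apply supp_ret in Hs as ->; now apply start_valid.
  - simpl in Hs; apply supp_bind in Hs as [s' [Hs' Hs]]; apply supp_bind in Hs as [K [HK Hs]].
    apply supp_ret in Hs as ->; apply supp_uniform in HK; apply grow_valid; auto.
Qed.

Lemma aug_is_pd k n : (2 <= k)%nat -> is_pd (aug k n).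
Proof.
  intros Hk; induction n as [|n IH]; simpl; [apply is_pd_ret|].
  apply is_pd_bind; [assumption|]; intros s Hs.
  apply is_pd_bind; [|intros; apply is_pd_ret].
  apply is_pd_uniform; eapply ktree_kcliques_nonempty.
  exact (vd_ktree _ _ _ (aug_valid k n s Hk Hs)).
Qed.

(** * One-step drift of the total depth and of the total weight *)

Definition weight (b : R) (G : graph) (t : detour) : R := Rpower (INR (deg G (via t))) b.

Definition total_depth (s : state) : R :=
  rsum (fun x => INR (length (snd s x))) (vertices (fst s)).

Definition total_weight (b : R) (s : state) : R :=
  rsum (fun x => rsum (weight b (fst s)) (snd s x)) (vertices (fst s)).

Lemma total_weight_nonneg b s : 0 <= total_weight b s.
Proof.
  apply rsum_nonneg; intros; apply rsum_nonneg; intros; apply Rlt_le, Rpower_pos.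
Qed.

Section Drift.

Variables (k n : nat) (b : R).
Hypotheses (Hk : (2 <= k)%nat) (Hb : 0 < b < 1).

Let B := Rpower (INR k) b.

Lemma INR_k_ge_2 : 2 <= INR k.
Proof. apply (le_INR 2); lia. Qed.

Section Step.

Variable G : graph.
Hypothesis HT : ktree k (S n) G.

Let N := INR k * INR (S n) + 1.

(** Rerouting and degree growth are separated into two indicators of [K], so that averaging reduces
    to counting cliques. In the rerouted case the growth term is merely nonnegative. *)
Lemma weight_refresh_le K t : In K (kcliques k G) -> sound k G t ->
  weight b (attach G K) (refresh K (nv G) t) <=
  weight b G t + ind (mem (src t) K && mem (dst t) K) * (B - weight b G t)
  + ind (mem (via t) K) * (b * (weight b G t / INR (deg G (via t)))).
Proof.
  intros HK Ht; pose proof (kt_wf _ _ _ HT) as HG.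
  assert (Hd : INR k <= INR (deg G (via t))) by (apply le_INR, (sd_deg _ _ _ Ht)).
  pose proof INR_k_ge_2 as Hk2.
  assert (Hp : 0 <= b * (weight b G t / INR (deg G (via t)))).
  { apply Rmult_le_pos; [lra|].
    apply Rlt_le, Rdiv_lt_0_compat; [apply Rpower_pos|lra]. }
  pose proof (ind_nonneg (mem (via t) K)) as Hi.
  unfold refresh; destruct (mem (src t) K && mem (dst t) K) eqn:E.
  - unfold weight at 1; simpl via.
    destruct k as [|j] eqn:Ek; [lia|].
    rewrite (deg_attach_new j) by assumption; fold B.
    pose proof (Rmult_le_pos _ _ Hi Hp); unfold ind at 1; lra.
  - unfold weight at 1; rewrite deg_attach_old by (assumption || apply (sd_via _ _ _ Ht)).
    rewrite plus_INR; fold (weight b G t).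
    unfold ind; destruct (mem (via t) K); simpl INR.
    + pose proof (Rpower_succ_le b (INR (deg G (via t))) Hb ltac:(lra)) as H.
      unfold weight; lra.
    + rewrite Rplus_0_r; unfold weight; lra.
Qed.

Lemma weight_ge t : sound k G t -> B <= weight b G t.
Proof.
  intros Ht; assert (Hd : INR k <= INR (deg G (via t))) by (apply le_INR, (sd_deg _ _ _ Ht)).
  pose proof INR_k_ge_2.
  apply Rle_Rpower_l; lra.
Qed.

(** A crude bound for the path copied by the new vertex: that path itself depends on [K], so the
    average over [K] for a fixed detour does not apply. The excess of 1 per detour is charged to the
    depth. *)
Lemma weight_refresh_le_succ K t : In K (kcliques k G) -> sound k G t ->
  weight b (attach G K) (refresh K (nv G) t) <= weight b G t + 1.
Proof.
  intros HK Ht; eapply Rle_trans; [now apply weight_refresh_le|].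
  assert (Hd : INR k <= INR (deg G (via t))) by (apply le_INR, (sd_deg _ _ _ Ht)).
  pose proof INR_k_ge_2 as Hk2.
  pose proof (weight_ge t Ht) as HB.
  assert (H1 : weight b G t / INR (deg G (via t)) <= 1).
  { apply Rmult_le_reg_r with (INR (deg G (via t))); [lra|].
    unfold Rdiv; rewrite Rmult_assoc, Rinv_l, Rmult_1_l, Rmult_1_r by lra.
    apply Rpower_le_base; [assumption|lra]. }
  assert (H0 : 0 <= weight b G t / INR (deg G (via t)))
    by (apply Rlt_le, Rdiv_lt_0_compat; [apply Rpower_pos|lra]).
  unfold ind; destruct (_ && _), (mem (via t) K); nra.
Qed.

(* The growth of the degree of [via t] is beaten by the rate at which the detour is rerouted,
   because b < 1. *)
Lemma weight_drift t : sound k G t ->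
  rsum (fun K => weight b (attach G K) (refresh K (nv G) t)) (kcliques k G) <=
  N * weight b G t + (INR k - 1) * (B - (1 - b) * weight b G t).
Proof.
  intros Ht.
  assert (Hd : INR k <= INR (deg G (via t))) by (apply le_INR, (sd_deg _ _ _ Ht)).
  pose proof INR_k_ge_2 as Hk2.
  pose proof (weight_ge t Ht) as HB.
  set (w := weight b G t) in *; set (d := INR (deg G (via t))) in *.
  apply Rle_trans with
    (rsum (fun K => (w * 1 + (B - w) * ind (mem (src t) K && mem (dst t) K))
       + (b * (w / d)) * ind (mem (via t) K)) (kcliques k G)).
  - apply rsum_le; intros K HK; eapply Rle_trans; [now apply weight_refresh_le|].
    fold w; fold d; lra.
  - rewrite !rsum_plus, !rsum_scal, (kt_num _ _ _ HT); fold N.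
    pose proof (sd_pair _ _ _ Ht) as H1.
    pose proof (kt_mem _ _ _ HT (via t) (sd_via _ _ _ Ht)) as H2; fold d in H2.
    set (n2 := rsum _ _) in H1 |- *; set (nw := rsum _ _) in H2 |- *.
    assert (Hp : 0 <= b * (w / d)).
    { apply Rmult_le_pos; [lra|]; apply Rlt_le, Rdiv_lt_0_compat; [apply Rpower_pos|lra]. }
    (* The degree in [kt_mem] cancels the denominator of the increment [b * (w / d)], leaving a
       drift linear in the weight. *)
    apply (Rmult_le_compat_l _ _ _ Hp) in H2.
    replace (b * (w / d) * ((INR k - 1) * d)) with ((INR k - 1) * (b * w)) in H2
      by (field; lra).
    (* By [weight_ge], [B - w] is at most 0, so the lower bound on [n2] gives an upper bound on the
       product. *)
    assert ((B - w) * n2 <= (B - w) * (INR k - 1)) by nra.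
    lra.
Qed.

End Step.

Lemma total_depth_grow s K : valid k n s -> In K (kcliques k (fst s)) ->
  total_depth (grow s K) = total_depth s + 1 + INR (length (snd s (last K 0%nat))).
Proof.
  destruct s as [G p]; intros Hv HK; unfold total_depth; simpl fst in *.
  rewrite vertices_attach, rsum_app, rsum_cons.
  rewrite (grow_new_path k) by (assumption || lia).
  rewrite (rsum_ext _ (fun x => INR (length (p x)))).
  - change (rsum _ []) with 0; cbn [length]; rewrite S_INR, length_map; simpl snd; lra.
  - intros x Hx; apply in_vertices in Hx; rewrite grow_old_path by assumption.
    now rewrite length_map.
Qed.

(** By [kt_own] each vertex is the parent for at most k choices of [K], so the depths of the parents
    add up to at most k times the total depth. *)
Lemma total_depth_drift s : valid k n s ->
  rsum (fun K => total_depth (grow s K)) (kcliques k (fst s)) <=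
  (INR k * INR (S n) + 1) * (total_depth s + 1) + INR k * total_depth s.
Proof.
  intros Hv; pose proof (vd_ktree _ _ _ Hv) as HT.
  rewrite (rsum_ext _ (fun K => (total_depth s + 1) * 1 + INR (length (snd s (last K 0%nat)))))
    by (intros K HK; rewrite total_depth_grow by assumption; ring).
  rewrite rsum_plus, rsum_scal, (kt_num _ _ _ HT).
  pose proof (kt_own _ _ _ HT (fun x => INR (length (snd s x))) (fun x => pos_INR _)) as H.
  cbv beta in H; fold (total_depth s) in H; lra.
Qed.

(** Three contributions: the new detour of weight [B], the copied path, bounded through
    [weight_refresh_le_succ] and [kt_own], and the old detours, controlled one by one by
    [weight_drift]. *)
Lemma total_weight_drift s : valid k n s ->
  rsum (fun K => total_weight b (grow s K)) (kcliques k (fst s)) <=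
  (INR k * INR (S n) + 1) * (total_weight b s + B)
  + (INR k - (INR k - 1) * (1 - b)) * total_weight b s
  + (INR k + (INR k - 1) * B) * total_depth s.
Proof.
  intros Hv; pose proof (vd_ktree _ _ _ Hv) as HT.
  pose proof (kt_wf _ _ _ HT) as HG.
  destruct s as [G p]; simpl fst in *.
  set (F := fun x => rsum (fun t => weight b G t + 1) (p x)).
  apply Rle_trans with
    (rsum (fun K => (B * 1 + rsum (fun x => rsum (fun t =>
        weight b (attach G K) (refresh K (nv G) t)) (p x)) (vertices G))
      + F (last K 0%nat)) (kcliques k G)).
  - apply rsum_le; intros K HK; unfold total_weight.
    change (fst (grow (G, p) K)) with (attach G K).
    rewrite vertices_attach, rsum_app, rsum_cons.
    change (rsum _ []) with 0.
    rewrite (grow_new_path k) by (assumption || lia); rewrite rsum_cons, rsum_map.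
    rewrite (rsum_ext (fun x => rsum (weight b (attach G K)) (snd (grow (G, p) K) x))
      (fun x => rsum (fun t => weight b (attach G K) (refresh K (nv G) t)) (p x))).
    + assert (E : weight b (attach G K) (Detour (nv G) (last K 0%nat) (nv G)) = B).
      { unfold weight; simpl via; destruct k as [|j]; [lia|].
        now rewrite (deg_attach_new j). }
      rewrite E.
      assert (rsum (fun t => weight b (attach G K) (refresh K (nv G) t)) (p (last K 0%nat))
              <= F (last K 0%nat)); [|lra].
      apply rsum_le; intros t Ht; apply weight_refresh_le_succ; try assumption.
      apply (vd_sound _ _ _ Hv (last K 0%nat)); [|assumption]; simpl.
      pose proof (kclique_last k G K ltac:(lia) HK) as Hm.
      destruct k as [|j]; [lia|].
      destruct (kclique_props j G K HK) as [_ [_ [HKv _]]]; now apply HKv.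
    + intros x Hx; apply in_vertices in Hx; rewrite grow_old_path by assumption.
      now rewrite rsum_map.
  - rewrite !rsum_plus, rsum_scal, (kt_num _ _ _ HT).
    set (N := INR k * INR (S n) + 1).
    assert (H1 : rsum (fun K => F (last K 0%nat)) (kcliques k G) <=
                 INR k * (total_weight b (G, p) + total_depth (G, p))).
    { eapply Rle_trans; [apply (kt_own _ _ _ HT F)|].
      - intros x; apply rsum_nonneg; intros t _; pose proof (Rpower_pos (INR (deg G (via t))) b).
        unfold weight; lra.
      - apply Req_le; f_equal; unfold total_weight, total_depth; simpl fst; simpl snd.
        rewrite <- rsum_plus; apply rsum_ext; intros x _; unfold F.
        rewrite rsum_plus, rsum_const; ring. }
    (* Old paths do not depend on [K], so the sum over [K] can be moved innermost and evaluated for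
       each detour. *)
    assert (H2 : rsum (fun K => rsum (fun x => rsum (fun t =>
        weight b (attach G K) (refresh K (nv G) t)) (p x)) (vertices G)) (kcliques k G)
      <= (N - (INR k - 1) * (1 - b)) * total_weight b (G, p)
         + (INR k - 1) * B * total_depth (G, p)).
    { rewrite rsum_swap; unfold total_weight, total_depth; simpl fst; simpl snd.
      rewrite <- !rsum_scal, <- rsum_plus; apply rsum_le; intros x Hx.
      apply in_vertices in Hx.
      rewrite rsum_swap, <- (Rmult_1_r (INR (length (p x)))), <- rsum_const, <- !rsum_scal,
        <- rsum_plus.
      apply rsum_le; intros t Ht.
      pose proof (weight_drift G HT t (vd_sound _ _ _ Hv x Hx t Ht)) as H; fold N in H; lra. }
    unfold N in *; lra.
Qed.

End Drift.

(** * Solving the recurrences for the expected totals *)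

Lemma length_kcliques k n G : ktree k n G ->
  INR (length (kcliques k G)) = INR k * INR n + 1.
Proof. intros HT; rewrite <- (kt_num _ _ _ HT), rsum_const; ring. Qed.

Lemma expect_aug_step k n (F : state -> R) (c0 c1 c2 : R) (H : state -> R) : (2 <= k)%nat ->
  (forall s, valid k n s -> rsum (fun K => F (grow s K)) (kcliques k (fst s)) <=
     c0 + c1 * F s + c2 * H s) ->
  (INR k * INR (S n) + 1) * expect (aug k (S n)) F <=
    c0 + c1 * expect (aug k n) F + c2 * expect (aug k n) H.
Proof.
  intros Hk HF; pose proof (aug_is_pd k n Hk) as Hpd.
  change (aug k (S n)) with (dbind (aug k n) (fun s =>
      dbind (uniform (kcliques k (fst s))) (fun K => dret (grow s K)))).
  rewrite expect_bind, <- (expect_const (aug k n) c0), <- !expect_scal, <- !expect_plus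
    by assumption.
  apply expect_le; [assumption|]; intros s Hs; apply aug_valid in Hs; [|assumption].
  rewrite expect_bind, expect_uniform, (length_kcliques k (S n)) by apply (vd_ktree _ _ _ Hs).
  rewrite (rsum_ext _ (fun K => F (grow s K))) by (intros; now rewrite expect_ret).
  pose proof (pos_INR k); pose proof (pos_INR (S n)).
  eapply Rle_trans; [apply Req_le|exact (HF s Hs)]; field; nra.
Qed.

(** The logarithm of [1 + x <= exp x] at [x = - / (m + 1)]. It replaces harmonic sums by
    logarithms. *)
Lemma inv_succ_le_ln m : 0 < m -> / (m + 1) <= ln (m + 1) - ln m.
Proof.
  intros Hm; pose proof (exp_ineq1_le (- / (m + 1))) as H.
  assert (E : 1 + - / (m + 1) = m / (m + 1)) by (field; lra).
  rewrite E in H.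
  apply ln_le in H; [|apply Rdiv_lt_0_compat; lra].
  rewrite ln_exp in H; unfold Rdiv in H.
  rewrite ln_mult, ln_Rinv in H by (try apply Rinv_0_lt_compat; lra); lra.
Qed.

Lemma total_depth_start k : total_depth (start k) = INR k.
Proof.
  unfold total_depth, start; simpl fst; rewrite vertices_attach, rsum_app, rsum_cons.
  rewrite (rsum_ext _ (fun _ => 1)).
  - rewrite rsum_const; unfold vertices; simpl nv; rewrite length_seq.
    simpl; rewrite Nat.ltb_irrefl; unfold rsum; simpl; ring.
  - intros x Hx; apply in_vertices in Hx; simpl in Hx; simpl snd.
    now apply Nat.ltb_lt in Hx as ->.
Qed.

Lemma total_weight_start k b : (2 <= k)%nat ->
  total_weight b (start k) = INR k * Rpower (INR k) b.
Proof.
  intros Hk; unfold total_weight, start; simpl fst; rewrite vertices_attach, rsum_app, rsum_cons.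
  pose proof (kt_wf _ _ _ (clique_graph_ktree k Hk)) as HG.
  rewrite (rsum_ext _ (fun _ => Rpower (INR k) b)).
  - rewrite rsum_const; unfold vertices; simpl nv; rewrite length_seq.
    simpl snd; rewrite Nat.ltb_irrefl; unfold rsum; simpl; ring.
  - intros x Hx; apply in_vertices in Hx; simpl in Hx; simpl snd.
    apply Nat.ltb_lt in Hx as Hx'; rewrite Hx', rsum_cons; change (rsum _ []) with 0.
    unfold weight; simpl via; rewrite deg_attach_old, deg_clique_graph by assumption.
    replace (mem x (seq 0 k)) with true
      by (symmetry; apply (reflect_iff _ _ (memP x _)), in_seq; lia).
    replace (k - 1 + 1)%nat with k by lia; ring.
Qed.

Lemma ln_INR_succ_nonneg n : 0 <= ln (INR (S n)).
Proof.
  rewrite <- ln_1; apply ln_le; [lra|]; rewrite S_INR; pose proof (pos_INR n); lra.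
Qed.

(** With N cliques the recurrence reads N E' <= (N + k) E + N. Hence E/N grows by at most 1/(N + k)
    per step, which is at most 1/(m + 1) and so at most the increment of the logarithm. *)
Lemma expect_total_depth k n : (2 <= k)%nat ->
  expect (aug k n) total_depth <= (INR k * INR (S n) + 1) * (1 + ln (INR (S n))).
Proof.
  intros Hk; pose proof (INR_k_ge_2 k Hk) as Hk2.
  induction n as [|n IH].
  - change (aug k 0) with (dret (start k)); rewrite expect_ret, total_depth_start.
    simpl INR; rewrite ln_1; lra.
  - pose proof (expect_aug_step k n total_depth (INR k * INR (S n) + 1)
      (INR k * INR (S n) + 1 + INR k) 0 total_depth Hk) as H.
    specialize (H ltac:(intros s Hs; pose proof (total_depth_drift k n Hk s Hs); lra)).
    set (E := expect (aug k n) total_depth) in *.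
    set (E' := expect (aug k (S n)) total_depth) in *.
    pose proof (inv_succ_le_ln (INR (S n)) ltac:(apply lt_0_INR; lia)) as Hln.
    pose proof (ln_INR_succ_nonneg n) as Hl.
    rewrite (S_INR (S n)); set (m := INR (S n)) in *.
    assert (Hm : 1 <= m) by (apply (le_INR 1); lia).
    set (N := INR k * m + 1) in *.
    assert (HN : 0 < N) by (unfold N; nra).
    assert (H1 : E' <= (N + INR k) * (1 + ln m) + 1).
    { apply Rmult_le_reg_l with N; [assumption|]; nra. }
    assert (HN1 : 1 <= (N + INR k) * (ln (m + 1) - ln m)).
    { apply Rle_trans with ((N + INR k) * / (m + 1)).
      - apply Rmult_le_reg_r with (m + 1); [lra|].
        rewrite Rmult_assoc, Rinv_l by lra; unfold N; nra.
      - apply Rmult_le_compat_l; lra. }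
    replace (INR k * (m + 1) + 1) with (N + INR k) by (unfold N; ring).
    lra.
Qed.

(** The damping [delta] absorbs the depth term, which is of order log n per step; otherwise the
    recurrence would produce a second logarithm. *)
Lemma expect_total_weight k b : (2 <= k)%nat -> 0 < b < 1 ->
  exists C, 0 < C /\ forall n,
    expect (aug k n) (total_weight b) <= C * (INR k * INR (S n) + 1) * (1 + ln (INR (S n))).
Proof.
  intros Hk Hb; pose proof (INR_k_ge_2 k Hk) as Hk2.
  set (B := Rpower (INR k) b); pose proof (Rpower_pos (INR k) b) as HB; fold B in HB.
  set (delta := (INR k - 1) * (1 - b)).
  assert (Hdelta : 0 < delta) by (apply Rmult_lt_0_compat; lra).
  set (A := INR k + (INR k - 1) * B).
  assert (HA : 0 < A) by (unfold A; nra).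
  (* The first summand lets [C * delta] absorb the depth term and the new detour; the second covers
     the initial weight. *)
  set (C := (A + B) / delta + B).
  assert (HCd : A + B <= C * delta).
  { replace (C * delta) with (A + B + B * delta) by (unfold C; field; lra); nra. }
  assert (HCB : B <= C).
  { unfold C; assert (0 < (A + B) / delta) by (apply Rdiv_lt_0_compat; lra); lra. }
  exists C; split; [lra|].
  induction n as [|n IH].
  - change (aug k 0) with (dret (start k)); rewrite expect_ret, total_weight_start by assumption.
    fold B; simpl INR; rewrite ln_1; nra.
  - pose proof (expect_aug_step k n (total_weight b) ((INR k * INR (S n) + 1) * B)
      (INR k * INR (S n) + 1 + (INR k - delta)) A total_depth Hk) as H.
    specialize (H ltac:(intros s Hs; pose proof (total_weight_drift k n b Hk Hb s Hs) as Hw;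
      fold B in Hw; fold delta in Hw; fold A in Hw; lra)).
    pose proof (expect_total_depth k n Hk) as HS.
    pose proof (inv_succ_le_ln (INR (S n)) ltac:(apply lt_0_INR; lia)) as Hln.
    pose proof (ln_INR_succ_nonneg n) as Hl.
    set (E := expect (aug k n) (total_weight b)) in *.
    set (E' := expect (aug k (S n)) (total_weight b)) in *.
    set (D := expect (aug k n) total_depth) in *.
    rewrite (S_INR (S n)); set (m := INR (S n)) in *.
    assert (Hm : 1 <= m) by (apply (le_INR 1); lia).
    set (N := INR k * m + 1) in *.
    assert (HN : 0 < N) by (unfold N; nra).
    set (u := 1 + ln m) in *.
    assert (Hdk : 0 <= INR k - delta) by (unfold delta; nra).
    assert (Hinv : 0 < / (m + 1)) by (apply Rinv_0_lt_compat; lra).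
    assert (H1 : E' <= B + (N + (INR k - delta)) * (C * u) + A * u).
    { apply Rmult_le_reg_l with N; [assumption|].
      assert ((N + (INR k - delta)) * E <= (N + (INR k - delta)) * (C * N * u))
        by (apply Rmult_le_compat_l; lra).
      assert (A * D <= A * (N * u)) by (apply Rmult_le_compat_l; lra).
      lra. }
    assert (H2 : (A + B) * u <= C * delta * u) by (apply Rmult_le_compat_r; unfold u; lra).
    assert (H3 : B <= B * u) by (unfold u; nra).
    assert (H4 : C * (N + INR k) * u <= C * (N + INR k) * (1 + ln (m + 1))).
    { apply Rmult_le_compat_l; [nra|unfold u; lra]. }
    replace (INR k * (m + 1) + 1) with (N + INR k) by (unfold N; ring).
    lra.
Qed.

(** * Uninformed vertices *)

Lemma expect_rsum {A C} (d : dist A) (F : C -> A -> R) l :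
  expect d (fun x => rsum (fun c => F c x) l) = rsum (fun c => expect d (F c)) l.
Proof.
  unfold expect; rewrite rsum_swap.
  apply rsum_ext; intros [p x] _; simpl; now rewrite <- rsum_scal.
Qed.

Lemma num_uninformed G I :
  INR (nv G) - INR (num_informed G I) = rsum (fun x => ind (negb (I x))) (vertices G).
Proof.
  unfold num_informed; rewrite length_filter_ind.
  enough (INR (nv G) = rsum (fun x => ind (negb (I x)) + ind (I x)) (vertices G)) as ->.
  { rewrite rsum_plus; ring. }
  rewrite (rsum_ext _ (fun _ => 1)).
  - rewrite rsum_const; unfold vertices; rewrite length_seq; ring.
  - intros x _; unfold ind; destruct (I x); simpl; ring.
Qed.

Lemma random_ktree_ktree k n G : (2 <= k)%nat -> supp (random_ktree k n) G -> ktree k n G.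
Proof.
  intros Hk; revert G; induction n as [|n IH]; intros G HG.
  - apply supp_ret in HG as ->; now apply clique_graph_ktree.
  - simpl in HG; apply supp_bind in HG as [G' [HG' HG]].
    apply supp_bind in HG as [K [HK HG]]; apply supp_ret in HG as ->.
    apply supp_uniform in HK; apply attach_ktree; auto.
Qed.

Lemma random_ktree_is_pd k n : (2 <= k)%nat -> is_pd (random_ktree k n).
Proof.
  intros Hk; induction n as [|n IH]; simpl; [apply is_pd_ret|].
  apply is_pd_bind; [assumption|]; intros G HG.
  apply is_pd_bind; [|intros; apply is_pd_ret].
  apply is_pd_uniform, (ktree_kcliques_nonempty k n), random_ktree_ktree; assumption.
Qed.

Lemma vertices_nonempty k n G : (2 <= k)%nat -> ktree k n G -> vertices G <> [].
Proof.
  intros Hk HT E; pose proof (kt_nv _ _ _ HT) as H.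
  assert (In 0%nat (vertices G)) by (apply in_vertices; lia).
  rewrite E in *; contradiction.
Qed.

Lemma informed_after_is_pd k n T : (2 <= k)%nat -> is_pd (informed_after k n T).
Proof.
  intros Hk; apply is_pd_bind; [now apply random_ktree_is_pd|]; intros G HG.
  apply random_ktree_ktree in HG; [|assumption].
  apply is_pd_bind; [apply is_pd_uniform; now apply (vertices_nonempty k n)|]; intros v0 _.
  apply is_pd_bind; [apply pushpull_is_pd, (kt_wf _ _ _ HG)|]; intros I _; apply is_pd_ret.
Qed.

Lemma informed_after_le k n T m : (2 <= k)%nat -> supp (informed_after k n T) m ->
  (m <= n + k)%nat.
Proof.
  intros Hk Hm; apply supp_bind in Hm as [G [HG Hm]].
  apply random_ktree_ktree in HG; [|assumption].
  apply supp_bind in Hm as [v0 [_ Hm]]; apply supp_bind in Hm as [I [_ Hm]].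
  apply supp_ret in Hm as ->; rewrite <- (kt_nv _ _ _ HG).
  unfold num_informed; eapply Nat.le_trans; [apply filter_length_le|].
  unfold vertices; now rewrite length_seq.
Qed.

(** Every path to the root [k] serves as often for its vertex as a source as for its vertex as a
    target, hence the factor 2 after averaging over the source. *)
Lemma mean_miss_le k n s T b : (2 <= k)%nat -> (0 < T)%nat -> 0 < b < 1 -> valid k n s ->
  let G := fst s in
  rsum (fun v0 => rsum (fun x => miss G x T (fun u => Nat.eqb u v0)) (vertices G)) (vertices G)
    / INR (length (vertices G)) <= Rpower (2 / INR T) b * (2 * total_weight b s).
Proof.
  intros Hk HT Hb Hv G; pose proof (vd_ktree _ _ _ Hv) as HG; fold G in HG.
  assert (HV : 0 < INR (length (vertices G))).
  { apply lt_0_INR; pose proof (vertices_nonempty k (S n) G Hk HG).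
    destruct (vertices G); [contradiction|simpl; lia]. }
  set (c := Rpower (2 / INR T) b).
  set (w := fun x => rsum (weight b G) (snd s x)).
  apply Rmult_le_reg_r with (INR (length (vertices G))); [assumption|].
  unfold Rdiv; rewrite Rmult_assoc, Rinv_l, Rmult_1_r by lra.
  apply Rle_trans with (rsum (fun v0 => rsum (fun x => c * (w x + w v0)) (vertices G))
    (vertices G)).
  - apply rsum_le; intros v0 Hv0; apply rsum_le; intros x Hx.
    apply in_vertices in Hv0; apply in_vertices in Hx.
    apply (miss_le_tolls G x v0 k); try assumption.
    + apply (kt_wf _ _ _ HG).
    + intros t Ht; apply (sd_crosses k), (vd_sound _ _ _ Hv x); assumption.
    + intros t Ht; apply (sd_crosses k), (vd_sound _ _ _ Hv v0); assumption.
    + intros t [Ht|Ht]; [pose proof (vd_sound _ _ _ Hv x Hx t Ht) as H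
                        |pose proof (vd_sound _ _ _ Hv v0 Hv0 t Ht) as H];
        apply sd_deg in H; fold G in H; lia.
    + now apply (vd_leads _ _ _ Hv).
    + now apply (vd_leads _ _ _ Hv).
    + apply Nat.eqb_refl.
  - apply Req_le; unfold total_weight; fold G; fold w.
    rewrite (rsum_ext _ (fun v0 => c * (rsum w (vertices G))
                                   + (c * INR (length (vertices G))) * w v0)).
    + rewrite rsum_plus, rsum_const, rsum_scal; ring.
    + intros v0 _; rewrite rsum_scal, rsum_plus, rsum_const; ring.
Qed.

Lemma expect_uninformed k n T b : (2 <= k)%nat -> (0 < T)%nat -> 0 < b < 1 ->
  expect (informed_after k (S n) T) (fun m => INR (S n + k) - INR m) <=
  2 * Rpower (2 / INR T) b * expect (aug k n) (total_weight b).
Proof.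
  intros Hk HT Hb; unfold informed_after.
  rewrite expect_bind, expect_aug, <- expect_scal.
  apply expect_le; [now apply aug_is_pd|]; intros s Hs; apply aug_valid in Hs; [|assumption].
  pose proof (mean_miss_le k n s T b Hk HT Hb Hs) as H; cbv zeta in H.
  set (G := fst s) in *.
  rewrite expect_bind, expect_uniform.
  rewrite (rsum_ext _ (fun v0 =>
    rsum (fun x => miss G x T (fun u => Nat.eqb u v0)) (vertices G))); [lra|].
  intros v0 _; rewrite expect_bind; unfold miss; rewrite <- expect_rsum.
  apply expect_ext; intros I _; rewrite expect_ret, <- num_uninformed.
  unfold G; now rewrite (kt_nv _ _ _ (vd_ktree _ _ _ Hs)).
Qed.

(** Markov's inequality for the number n + k - m of uninformed vertices, which exceeds [g] whenever
    m < n - g. *)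
Lemma prob_informed_ge k n T g : (2 <= k)%nat -> 0 < g ->
  1 - expect (informed_after k n T) (fun m => INR (n + k) - INR m) / g <=
  prob (informed_after k n T) (fun m => if Rle_dec (INR n - g) (INR m) then true else false).
Proof.
  intros Hk Hg; pose proof (informed_after_is_pd k n T Hk) as Hpd.
  assert (Hg' : 0 < / g) by now apply Rinv_0_lt_compat.
  rewrite prob_expect.
  replace (1 - _) with (expect (informed_after k n T)
      (fun m => 1 + (- / g) * (INR (n + k) - INR m)))
    by (rewrite expect_plus, expect_const, expect_scal by assumption; unfold Rdiv; ring).
  apply expect_le; [assumption|]; intros m Hm; apply informed_after_le in Hm; [|assumption].
  apply le_INR in Hm; destruct (Rle_dec (INR n - g) (INR m)) as [H|H]; simpl ind.
  - assert (0 <= / g * (INR (n + k) - INR m)) by (apply Rmult_le_pos; lra); lra.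
  - apply Rnot_le_lt in H; rewrite plus_INR; pose proof (pos_INR k).
    assert (/ g * g <= / g * (INR n + INR k - INR m)) by (apply Rmult_le_compat_l; lra).
    rewrite Rinv_l in * by lra; lra.
Qed.

(** * Asymptotics and the number of rounds *)

Lemma nrounds_ge x : 0 < x -> x <= INR (nrounds x).
Proof.
  intros Hx; destruct (archimed x) as [H _]; unfold nrounds.
  rewrite INR_IZR_INZ, Z2Nat.id; [lra|].
  apply le_IZR; lra.
Qed.

Lemma lnln_eventually M : exists N, forall n, (N <= n)%nat -> M <= ln (ln (INR n)).
Proof.
  exists (nrounds (exp (exp M))); intros n Hn; apply le_INR in Hn.
  pose proof (nrounds_ge (exp (exp M)) (exp_pos _)).
  rewrite <- (ln_exp M); apply ln_le; [apply exp_pos|].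
  rewrite <- (ln_exp (exp M)); apply ln_le; [apply exp_pos|]; lra.
Qed.

Lemma Rpower_lnln_vanishes c eps : 0 < c -> 0 < eps ->
  exists N, forall n, (N <= n)%nat -> Rpower (ln (ln (INR n))) (- c) <= eps.
Proof.
  (* This threshold is the [(- 1 / c)]-th power of [eps]. *)
  intros Hc He; destruct (lnln_eventually (exp (- ln eps / c))) as [N HN].
  exists N; intros n Hn; specialize (HN n Hn); unfold Rpower.
  apply ln_le in HN; [|apply exp_pos]; rewrite ln_exp in HN.
  rewrite <- (exp_ln eps) by assumption.
  assert (H : - c * ln (ln (ln (INR n))) <= ln eps).
  { apply (Rmult_le_compat_l c) in HN; [|lra].
    replace (c * (- ln eps / c)) with (- ln eps) in HN by (field; lra); lra. }
  destruct H as [H|H]; [left; now apply exp_increasing|right; now rewrite H].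
Qed.

(** The exponent b = k/(k+2) satisfies (1 + 2/k) b = 1, so one full factor [L] is gained, matching
    the logarithm in the expected total weight. The leading 2 bounds 2^b. *)
Lemma Rpower_rounds_le k L l x : (2 <= k)%nat -> 0 < L -> 0 < l ->
  Rpower L (1 + 2 / INR k) * l <= x ->
  Rpower (2 / x) (INR k / (INR k + 2)) <= 2 * / (L * Rpower l (INR k / (INR k + 2))).
Proof.
  intros Hk HL Hl Hx; pose proof (INR_k_ge_2 k Hk) as Hk2.
  set (b := INR k / (INR k + 2)).
  assert (Hb : 0 < b < 1).
  { unfold b; split; [apply Rdiv_lt_0_compat; lra|].
    apply Rmult_lt_reg_r with (INR k + 2); [lra|].
    unfold Rdiv; rewrite Rmult_assoc, Rinv_l; lra. }
  set (y := Rpower L (1 + 2 / INR k) * l) in *.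
  assert (Hy : 0 < y) by (apply Rmult_lt_0_compat; [apply Rpower_pos|assumption]).
  assert (E : Rpower y b = L * Rpower l b).
  { unfold y; rewrite <- Rpower_mult_distr, Rpower_mult by (apply Rpower_pos || assumption).
    replace ((1 + 2 / INR k) * b) with 1 by (unfold b; field; lra).
    now rewrite Rpower_1. }
  rewrite <- E.
  assert (H2 : 2 / x <= 2 / y).
  { apply Rmult_le_compat_l; [lra|]; apply Rinv_le_contravar; lra. }
  eapply Rle_trans; [apply (Rle_Rpower_l (2 / x) (2 / y) b); [lra|]|].
  - split; [apply Rdiv_lt_0_compat; lra|assumption].
  - unfold Rdiv; rewrite <- Rpower_mult_distr by (try apply Rinv_0_lt_compat; lra).
    assert (Ei : Rpower (/ y) b = / Rpower y b).
    { unfold Rpower; rewrite ln_Rinv, <- exp_Ropp by assumption; f_equal; ring. }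
    rewrite Ei; apply Rmult_le_compat_r.
    + apply Rlt_le, Rinv_0_lt_compat, Rpower_pos.
    + apply Rpower_le_base; lra.
Qed.

Theorem theorem1 :
  forall (k : nat), (2 <= k)%nat ->
  forall f : nat -> R,
    (forall M : R, exists N : nat, forall n : nat, (N <= n)%nat -> M <= f n) ->
    (forall eps : R, 0 < eps -> exists N : nat, forall n : nat, (N <= n)%nat ->
        Rabs (f n) <= eps * ln (ln (INR n))) ->
  exists C : R, 0 < C /\
  exists g : nat -> R,
    (forall eps : R, 0 < eps -> exists N : nat, forall n : nat, (N <= n)%nat ->
        Rabs (g n) <= eps * INR n) /\
    (forall eps : R, 0 < eps -> exists N : nat, forall n : nat, (N <= n)%nat ->
        1 - eps <= prob (informed_after k n (nrounds (round_bound C k n f)))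
                        (fun m => if Rle_dec (INR n - g n) (INR m) then true else false)).
Proof.
  intros k Hk f Hf _; pose proof (INR_k_ge_2 k Hk) as Hk2.
  set (b := INR k / (INR k + 2)).
  assert (Hb : 0 < b < 1).
  { unfold b; split; [apply Rdiv_lt_0_compat; lra|].
    apply Rmult_lt_reg_r with (INR k + 2); [lra|].
    unfold Rdiv; rewrite Rmult_assoc, Rinv_l; lra. }
  destruct (expect_total_weight k b Hk Hb) as [C [HC HW]].
  exists 1; split; [lra|].
  (* The expected number of uninformed vertices is O(n l^(-b)) with l = log log n. Half of the
     exponent makes [g] sublinear, the other half makes the Markov bound vanish. *)
  exists (fun n => INR n * Rpower (ln (ln (INR n))) (- (b / 2))); split; intros eps Heps.
  - destruct (Rpower_lnln_vanishes (b / 2) eps ltac:(lra) Heps) as [N HN].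
    exists N; intros n Hn; specialize (HN n Hn).
    pose proof (pos_INR n); pose proof (Rpower_pos (ln (ln (INR n))) (- (b / 2))).
    rewrite Rabs_pos_eq by nra; nra.
  (* The 8 collects three factors 2: source and target paths, the bound on 2^b, and 1 + L <= 2 L. *)
  - set (D := 8 * C * (INR k + 1)).
    assert (HD : 0 < D) by (unfold D; nra).
    destruct (Rpower_lnln_vanishes (b / 2) (eps / D) ltac:(lra)
                ltac:(apply Rdiv_lt_0_compat; lra)) as [N1 HN1].
    destruct (Hf 1) as [N2 HN2].
    destruct (lnln_eventually 1) as [N3 HN3].
    exists (S (N1 + N2 + N3)); intros n Hn.
    specialize (HN1 n ltac:(lia)); specialize (HN2 n ltac:(lia)); specialize (HN3 n ltac:(lia)).
    destruct n as [|n]; [lia|].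
    assert (Hn1 : 1 <= INR (S n)) by (apply (le_INR 1); lia).
    set (L := ln (INR (S n))) in *; set (l := ln L) in *.
    assert (HL0 : 0 <= L) by apply ln_INR_succ_nonneg.
    assert (HL : 1 <= L).
    { apply Rnot_lt_le; intros HL.
      (* For 0 < L < 1 the logarithm [l] is negative; for L = 0 it takes the default value 0. Both
         contradict l >= 1. *)
      destruct HL0 as [HL0|HL0].
      - assert (l < ln 1) by now apply ln_increasing.
        rewrite ln_1 in *; lra.
      - unfold l in HN3; rewrite <- HL0 in HN3; unfold ln in HN3.
        destruct (Rlt_dec 0 0); lra. }
    set (x := round_bound 1 k (S n) f).
    assert (Hx : Rpower L (1 + 2 / INR k) * l <= x).
    { unfold x, round_bound; fold L; fold l.
      assert (1 <= Rpower (f (S n)) (3 / INR k)).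
      { rewrite <- (Rpower_O (f (S n))) by lra; apply Rle_Rpower; [lra|].
        apply Rlt_le, Rdiv_lt_0_compat; lra. }
      pose proof (Rpower_pos L (1 + 2 / INR k)).
      rewrite Rmult_1_l; rewrite <- (Rmult_1_r (_ * l)) at 1.
      apply Rmult_le_compat_l; [nra|assumption]. }
    assert (Hx0 : 0 < x).
    { eapply Rlt_le_trans; [|exact Hx].
      apply Rmult_lt_0_compat; [apply Rpower_pos|lra]. }
    pose proof (nrounds_ge x Hx0) as HT.
    set (T := nrounds x) in *.
    assert (HT0 : (0 < T)%nat) by (apply INR_lt; simpl INR; lra).
    set (g := INR (S n) * Rpower l (- (b / 2))).
    assert (Hg : 0 < g) by (apply Rmult_lt_0_compat; [lra|apply Rpower_pos]).
    eapply Rle_trans; [|apply (prob_informed_ge k (S n) T g Hk Hg)].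
    enough (expect (informed_after k (S n) T) (fun m => INR (S n + k) - INR m) <= eps * g).
    { apply Rplus_le_compat_l, Ropp_le_contravar.
      apply Rmult_le_reg_r with g; [assumption|].
      unfold Rdiv; rewrite Rmult_assoc, Rinv_l; lra. }
    eapply Rle_trans; [apply (expect_uninformed k n T b Hk HT0 Hb)|].
    pose proof (Rpower_rounds_le k L l (INR T) Hk ltac:(lra) ltac:(lra) ltac:(lra)) as HR.
    fold b in HR; specialize (HW n); fold L in HW.
    set (E := expect (aug k n) (total_weight b)) in *.
    set (P := Rpower (2 / INR T) b) in *.
    assert (HP : 0 < P) by apply Rpower_pos.
    set (q := Rpower l (- (b / 2))) in *.
    assert (Hq : 0 < q) by apply Rpower_pos.
    assert (Eq : / (L * Rpower l b) = q * q / L).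
    { rewrite Rinv_mult, <- Rpower_Ropp.
      unfold q; rewrite <- Rpower_plus.
      replace (- (b / 2) + - (b / 2)) with (- b) by field; unfold Rdiv; ring. }
    rewrite Eq in HR.
    (* The clique count k(n+1) + 1 is at most (k+1)(n+1), and 1 + L is at most 2 L. *)
    assert (HE : E <= C * ((INR k + 1) * INR (S n)) * (2 * L)).
    { eapply Rle_trans; [exact HW|]; apply Rmult_le_compat; [apply Rmult_le_pos; nra|lra| |lra].
      apply Rmult_le_compat_l; lra. }
    apply Rle_trans with
      (2 * (2 * (q * q / L)) * (C * ((INR k + 1) * INR (S n)) * (2 * L))).
    { apply Rmult_le_compat; [lra| |lra|assumption].
      rewrite <- (expect_const (aug k n) 0) by now apply aug_is_pd.
      apply expect_le; [now apply aug_is_pd|]; intros s _; apply total_weight_nonneg. }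
    replace (2 * (2 * (q * q / L)) * (C * ((INR k + 1) * INR (S n)) * (2 * L)))
      with (D * q * g) by (unfold D, g; field; lra).
    apply Rmult_le_compat_r; [lra|].
    apply (Rmult_le_compat_l D) in HN1; [|lra].
    replace (D * (eps / D)) with eps in HN1 by (field; lra); exact HN1.
Qed.
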